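(* In the integer setting, there is an algorithm solving $P^{\delta,\varepsilon}_{\mathrm{count}}$ with cost $$O\Bigl(\frac{(n/\delta)\log\frac n\gamma+n^2\log n\log\frac1\gamma}{\varepsilon^2}+n\log q\Bigr).$$
   Context: Setup. Let $n\ge2$ be an integer, $\mathcal H=\{0,1,\dots,n\}$. An instance consists of nonnegative counts $c_x$, $x\in\mathcal H$, not all zero, and reals $\beta_{\min}<\beta_{\max}$. Let $Z(\beta)=\sum_x c_xe^{\beta x}$, $\mu_\beta(x)=c_xe^{\beta x}/Z(\beta)$, $Q(\beta)=Z(\beta)/Z(\beta_{\min})$, $q=\log Q(\beta_{\max})$. An algorithm accesses the instance only through an oracle which, on any query $\beta\in[\beta_{\min},\beta_{\max}]$ (chosen adaptively), returns an independent sample from $\mu_\beta$; cost means expected number of oracle calls. $\delta,\varepsilon,\gamma\in(0,1)$. In cost bounds $q$ stands for $\max\{1,q\}$; $O(\cdot)$ constants are absolute. Let $\pi(x)=\mu_{\beta_{\min}}(x)$ and $\Delta(x)=\max_{\beta\in[\beta_{\min},\beta_{\max}]}\mu_\beta(x)$. Problem $P^{\delta,\varepsilon}_{\mathrm{count}}$: output vectors $\hat\pi,u$ indexed by $\mathcal H$ such that, with probability at least $1-\gamma$: (i) for every $x$ with $c_x\ne0$, $|\hat\pi(x)-\pi(x)|\le u(x)\le\varepsilon\pi(x)(1+\delta/\Delta(x))$; (ii) for every $x$ with $c_x=0$, $\hat\pi(x)=0$. *)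

(* Defs.v *)
From HB Require Import structures.
From mathcomp Require Import all_boot all_order all_algebra.
From mathcomp Require Import all_classical all_reals all_analysis.
Set Implicit Arguments.
Unset Strict Implicit.
Unset Printing Implicit Defensive.
Import Order.TTheory GRing.Theory Num.Theory.
Import numFieldNormedType.Exports.
Local Open Scope classical_set_scope.
Local Open Scope ring_scope.

Section Gibbs.
Variables (R : realType) (n : nat).
Implicit Types (c : 'I_n.+1 -> R) (beta bmin bmax : R) (x : 'I_n.+1).

(* Counts are indexed by {0, ..., n}; they are allowed to be any nonnegative
   reals, only their ratios matter. *)
Definition valid_counts c : Prop :=
  (forall x, 0 <= c x) /\ (exists x, c x != 0).

Definition partition_fun c beta : R := \sum_x c x * expR (beta * x%:R).

Definition gibbs c beta x : R :=
  c x * expR (beta * x%:R) / partition_fun c beta.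

Definition log_partition_ratio c bmin bmax : R :=
  ln (partition_fun c bmax / partition_fun c bmin).

(* The supremum is a maximum: gibbs c ^~ x is continuous in beta. *)
Definition max_gibbs c bmin bmax x : R :=
  sup [set gibbs c beta x | beta in `[bmin, bmax]].

Definition count_correct c bmin bmax (delta eps : R)
    (pihat u : 'I_n.+1 -> R) : Prop :=
  (forall x, c x != 0 ->
     `|pihat x - gibbs c bmin x| <= u x /\
     u x <= eps * gibbs c bmin x * (1 + delta / max_gibbs c bmin bmax x)) /\
  (forall x, c x = 0 -> pihat x = 0).

End Gibbs.

(* A randomized adaptive algorithm with oracle access at inverse temperatures
   in [bmin, bmax].  It draws a seed once, carrying all of its internal
   randomness; afterwards its behaviour is a function of the seed and of the
   history h of oracle answers received so far (oldest first; the past queries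
   are themselves determined by the seed and h).  With history h it either
   halts and returns (estimate h, radius h), or calls the oracle at query h.
   The counts are not an argument of any of these functions. *)
Record algorithm (R : realType) (n : nat) (bmin bmax : R) := Algorithm {
  seed_display : measure_display ;
  seed : measurableType seed_display ;
  seed_law : probability seed R ;
  halts : seed -> seq 'I_n.+1 -> bool ;
  query : seed -> seq 'I_n.+1 -> R ;
  estimate : seed -> seq 'I_n.+1 -> 'I_n.+1 -> R ;
  radius : seed -> seq 'I_n.+1 -> 'I_n.+1 -> R ;
  query_in_range : forall w h, query w h \in `[bmin, bmax] ;
  measurable_halts : forall h, measurable_fun [set: seed] (halts ^~ h) ;
  measurable_query : forall h, measurable_fun [set: seed] (query ^~ h) ;
  measurable_estimate : forall h x,
    measurable_fun [set: seed] (fun w => estimate w h x) ;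
  measurable_radius : forall h x,
    measurable_fun [set: seed] (fun w => radius w h x)
}.

Section Runs.
Variables (R : realType) (n : nat) (bmin bmax : R).
Variables (A : algorithm n bmin bmax) (c : 'I_n.+1 -> R).

(* h is the complete list of answers of a terminating run with seed w *)
Definition complete_run (w : seed A) (h : seq 'I_n.+1) : Prop :=
  (forall i, (i < size h)%N -> ~~ halts w (take i h)) /\ halts w h.

(* Probability, given the seed, that the first size h calls are answered by h:
   each answer is a fresh sample from the Gibbs distribution at the query. *)
Definition answers_prob (w : seed A) (h : seq 'I_n.+1) : R :=
  \prod_(i < size h) gibbs c (query w (take i h)) (nth ord0 h i).

(* Expectation of F over the terminating runs (runs are integrated over the
   seed and summed over the countably many possible answer lists). *)
Definition run_integral (F : seed A -> seq 'I_n.+1 -> \bar R) : \bar R :=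
  (\int[seed_law A]_w
     \esum_(h in complete_run w) ((answers_prob w h)%:E * F w h))%E.

Definition run_probability (E : seed A -> seq 'I_n.+1 -> Prop) : \bar R :=
  run_integral (fun w h => (\1_(E w) h)%:E).

(* A run that never terminates makes infinitely many calls; 0 * +oo = 0, so the
   second summand vanishes exactly when the algorithm terminates almost surely. *)
Definition expected_calls : \bar R :=
  (run_integral (fun _ h => (size h)%:R%:E)
   + (1 - run_probability (fun _ _ => True)) * +oo)%E.

Definition success_probability (delta eps : R) : \bar R :=
  run_probability (fun w h =>
    count_correct c bmin bmax delta eps (estimate w h) (radius w h)).

End Runs.

Definition count_cost_bound (R : realType) (n : nat)
    (delta eps gamma q : R) : R :=
  (n%:R / delta * ln (n%:R / gamma)
   + n%:R ^+ 2 * ln n%:R * ln (1 / gamma)) / eps ^+ 2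
  + n%:R * ln (Num.max 1 q).

(* Main.v *)
Require Import Defs.
From HB Require Import structures.
From mathcomp Require Import all_boot all_order all_algebra.
From mathcomp Require Import all_classical all_reals all_analysis.
From mathcomp Require Import ring lra.
Import Order.TTheory GRing.Theory Num.Theory.
Import numFieldNormedType.Exports.
Set Implicit Arguments.
Unset Strict Implicit.
Unset Printing Implicit Defensive.
Local Open Scope classical_set_scope.
Local Open Scope ring_scope.

(* For every threshold k the algorithm searches a temperature b_k at which
   {X >= k} and {X < k} both have probability at least 1/4, unless b_k is stopped
   by an end of the interval.  As the states are integers, the log-odds of
   {X >= k} increase in beta with slope between 1 and n: single samples are
   exponentially reliable far from the crossing, so that doubling the distance to
   bmax followed by a bisection needs only O(log q + n log(n/gamma)) samples.
   At such a point mu_{b_x}(x) >= Delta(x) / 4.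
   For b = b_i and b' = b_{i+1}, the ratio Z(b')/Z(b) is, up to a known factor,
   E_b[min(1, e^((b'-b)(X-i)))] / E_b'[min(1, e^((b-b')(X-i)))] (Bennett), and
   both means are at least 1/4.  Hence about n log(n/gamma) / eps^2 samples per
   temperature estimate all products of consecutive ratios within a factor
   1 + eps, while log(n/gamma) / (delta eps^2) samples control the frequency of x
   at b_x; pi(x) is that frequency times the estimated ratio of partition
   functions.  Union bounds are affordable since for gamma <= 1/2 one has
   log(n/gamma) <= 4 log n log(1/gamma). *)

(** * Adaptive sampling programs *)

(** Estimating each of the n consecutive ratios within a factor 1 + eps/n would take about n^2/eps^2
    samples per temperature. Instead, the logarithm of a product of normalised averages u_i is the
    sum of the u_i - 1 plus a quadratic remainder. The remainder only needs every u_i to be within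
    order sqrt(eps/n) of 1, and the sum, treated as one random variable, has variance of order n/N;
    so N of order n log(n/gamma)/eps^2 serves both. A second obstacle is that bmax - bmin must not
    enter the cost. To the left of bmax the mass of {X >= k}, k >= 1, is at most e^(q - distance),
    so in expectation the doubling stops at a distance of about q; the length of the interval enters
    only the recursion fuel, which is not a number of calls. Programs are finite decision trees:
    every run halts, and probabilities and expected calls are finite sums defined by recursion.
    [compiled] turns them into history-based algorithms. *)

Inductive prog (B X T : Type) : Type :=
| Ret of T
| Ask of B & (X -> prog B X T).
Arguments Ret {B X T}.
Arguments Ask {B X T}.

Fixpoint bind B X T U (p : prog B X T) (f : T -> prog B X U) : prog B X U :=
  match p with
  | Ret t => f t
  | Ask b k => Ask b (fun x => bind (k x) f)
  end.

Section Programs.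
Variables (R : realType) (B : Type) (X : finType).

Section Semantics.
Variable mu : B -> X -> R.

Fixpoint expect T (f : T -> R) (p : prog B X T) : R :=
  match p with
  | Ret t => f t
  | Ask b k => \sum_x mu b x * expect f (k x)
  end.

Fixpoint calls T (p : prog B X T) : R :=
  match p with
  | Ret _ => 0
  | Ask b k => 1 + \sum_x mu b x * calls (k x)
  end.

Definition prob T (P : T -> Prop) (p : prog B X T) : R :=
  expect (fun t => `[< P t >]%:R) p.

Lemma expect_bind T U (p : prog B X T) (g : T -> prog B X U) f :
  expect f (bind p g) = expect (fun t => expect f (g t)) p.
Proof. by elim: p => //= b k ih; apply: eq_bigr => x _; rewrite ih. Qed.

Hypothesis mu_ge0 : forall b x, 0 <= mu b x.
Hypothesis mu_sum1 : forall b, \sum_x mu b x = 1.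

Lemma eq_expect T (f g : T -> R) p : f =1 g -> expect f p = expect g p.
Proof. by move=> fg; elim: p => //= b k ih; apply: eq_bigr => x _; rewrite ih. Qed.

Lemma expect_const T a (p : prog B X T) : expect (fun=> a) p = a.
Proof.
elim: p => //= b k ih; under eq_bigr do rewrite ih.
by rewrite -mulr_suml mu_sum1 mul1r.
Qed.

Lemma le_expect T (f g : T -> R) p :
  (forall t, f t <= g t) -> expect f p <= expect g p.
Proof.
move=> fg; elim: p => //= b k ih.
by apply: ler_sum => x _; apply: ler_wpM2l.
Qed.

Lemma expectD T (f g : T -> R) p :
  expect (fun t => f t + g t) p = expect f p + expect g p.
Proof.
elim: p => //= b k ih; rewrite -big_split /=.
by apply: eq_bigr => x _; rewrite ih mulrDr.
Qed.

Lemma expectZ T (f : T -> R) a p :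
  expect (fun t => a * f t) p = a * expect f p.
Proof.
elim: p => //= b k ih; rewrite mulr_sumr.
by apply: eq_bigr => x _; rewrite ih mulrCA.
Qed.

Lemma calls_bind T U (p : prog B X T) (g : T -> prog B X U) :
  calls (bind p g) = calls p + expect (fun t => calls (g t)) p.
Proof.
elim: p => [t|b k ih] /=; first by rewrite add0r.
rewrite -addrA -big_split; congr (_ + _).
by apply: eq_bigr => x _; rewrite ih mulrDr.
Qed.

Lemma calls_ge0 T (p : prog B X T) : 0 <= calls p.
Proof.
elim: p => //= b k ih; apply: addr_ge0 => //.
by apply: sumr_ge0 => x _; apply: mulr_ge0.
Qed.

Lemma calls_bind_le T U (p : prog B X T) (g : T -> prog B X U) a :
  (forall t, calls (g t) <= a) -> calls (bind p g) <= calls p + a.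
Proof.
move=> ga; rewrite calls_bind lerD2l -[leRHS](expect_const a p).
exact: le_expect.
Qed.

Lemma prob_ge0 T P (p : prog B X T) : 0 <= prob P p.
Proof. by rewrite -[leLHS](expect_const 0 p); apply: le_expect => t. Qed.

Lemma prob_le1 T P (p : prog B X T) : prob P p <= 1.
Proof.
rewrite -[leRHS](expect_const 1 p); apply: le_expect => t.
by case: asbool; rewrite ?ler01.
Qed.

Lemma sub_prob T (P Q : T -> Prop) p :
  (forall t, P t -> Q t) -> prob P p <= prob Q p.
Proof.
move=> PQ; apply: le_expect => t; rewrite ler_nat.
by case: (asboolP (P t)) => // /PQ /asboolT ->.
Qed.

Lemma probC T (P : T -> Prop) p : prob (fun t => ~ P t) p = 1 - prob P p.
Proof.
rewrite -[1](expect_const 1 p) -mulN1r -expectZ -expectD.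
apply: eq_expect => t; rewrite asbool_neg.
by case: asbool => /=; rewrite mulN1r ?oppr0 ?addr0 ?subrr.
Qed.

Lemma prob_or T (P Q : T -> Prop) p :
  prob (fun t => P t \/ Q t) p <= prob P p + prob Q p.
Proof.
rewrite -expectD; apply: le_expect => t; rewrite asbool_or -natrD ler_nat.
by case: asbool; case: asbool.
Qed.

Lemma prob_exists T n (P : 'I_n -> T -> Prop) p :
  prob (fun t => exists i, P i t) p <= \sum_i prob (P i) p.
Proof.
elim: n P => [|n ih] P.
  rewrite big_ord0 -[leRHS](expect_const 0 p); apply: le_expect => t.
  by rewrite asboolF //; case=> -[].
rewrite big_ord_recl; apply: le_trans (_ : _ <= prob (fun t => P ord0 t \/
  exists i, P (lift ord0 i) t) p) _.
  apply: sub_prob => t [i]; case: (unliftP ord0 i) => [j ->|->]; last by left.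
  by right; exists j.
by apply: le_trans (prob_or _ _ _) _; rewrite lerD2l; apply: ih.
Qed.

Lemma prob_exists_le T n (P : 'I_n -> T -> Prop) p a :
  (forall i, prob (P i) p <= a) -> prob (fun t => exists i, P i t) p <= n%:R * a.
Proof.
move=> Pa; apply: le_trans (prob_exists _ _) _.
by apply: le_trans (ler_sum _ (fun i _ => Pa i)) _; rewrite sumr_const card_ord mulr_natl.
Qed.

(** Union bound along a composition: [P] says that the first stage went well; where it fails, the
    second stage is bounded by 1 only. *)
Lemma prob_bind T U (p : prog B X T) (g : T -> prog B X U) (P : T -> Prop)
    (Q : U -> Prop) a b :
  0 <= b -> prob (fun t => ~ P t) p <= a -> (forall t, P t -> prob Q (g t) <= b) ->
  prob Q (bind p g) <= a + b.
Proof.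
move=> b0 pa gb; rewrite /prob expect_bind.
apply: le_trans (_ : _ <= expect (fun t => `[< ~ P t >]%:R + b) p) _.
  apply: le_expect => t; case: (asboolP (P t)) => [Pt|nPt].
    by rewrite asboolF /= ?add0r; [exact: gb|move=> /(_ Pt)].
  rewrite asboolT //=; apply: le_trans (prob_le1 _ _) _.
  by rewrite lerDl.
by rewrite expectD expect_const lerD2r.
Qed.

Lemma markov_exp T (P : T -> Prop) (f : T -> R) p :
  (forall t, P t -> 0 <= f t) -> prob P p <= expect (fun t => expR (f t)) p.
Proof.
move=> Pf; apply: le_expect => t; case: (asboolP (P t)) => [/Pf ft|_].
  by rewrite -expR0 ler_expR.
exact: expR_ge0.
Qed.

End Semantics.

Fixpoint mapM A T (f : A -> prog B X T) (s : seq A) : prog B X (seq T) :=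
  match s with
  | [::] => Ret [::]
  | a :: s' => bind (f a) (fun t => bind (mapM f s') (fun r => Ret (t :: r)))
  end.

Definition ask (b : B) : prog B X X := Ask b Ret.

Section Iteration.
Variable mu : B -> X -> R.
Hypothesis mu_ge0 : forall b x, 0 <= mu b x.
Hypothesis mu_sum1 : forall b, \sum_x mu b x = 1.

Lemma expect_ask b f : expect mu f (ask b) = \sum_x mu b x * f x.
Proof. by []. Qed.

Lemma calls_ask b : calls mu (ask b) = 1.
Proof. by rewrite /= big1 ?addr0 // => x _; rewrite mulr0. Qed.

Lemma calls_mapM A T (f : A -> prog B X T) (s : seq A) a :
  (forall x, calls mu (f x) <= a) -> calls mu (mapM f s) <= (size s)%:R * a.
Proof.
move=> fa; elim: s => [|x s ih] /=; first by rewrite mul0r.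
rewrite mulrSr mulrDl mul1r addrC.
apply: le_trans (lerD (fa x) ih); apply: calls_bind_le => // t.
by rewrite -[leRHS]addr0; apply: calls_bind_le.
Qed.

(** Independence: the runs share no answers, so the expectation of a product over positions
    factorises. With exponentials as [phi] this yields moment generating functions of sums. *)
Lemma expect_mapM_prod A T (f : A -> prog B X T) (s : seq A) a0 t0
    (phi : nat -> T -> R) :
  expect mu (fun r => \prod_(i < size s) phi i (nth t0 r i)) (mapM f s) =
  \prod_(i < size s) expect mu (phi i) (f (nth a0 s i)).
Proof.
elim: s phi => [|a s ih] phi /=; first by rewrite !big_ord0.
rewrite big_ord_recl expect_bind /= mulrC -expectZ.
apply: eq_expect => t; rewrite expect_bind /=.
under eq_expect do rewrite big_ord_recl /=.
by rewrite expectZ mulrC (ih (fun i => phi i.+1)).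
Qed.

Lemma expect_mapM_nseq A T (f : A -> prog B X T) a m (phi : T -> R) :
  expect mu (fun r => \prod_(t <- r) phi t) (mapM f (nseq m a)) =
  expect mu phi (f a) ^+ m.
Proof.
elim: m => [|m ih] /=; first by rewrite big_nil expr0.
rewrite expect_bind /= exprS mulrC -expectZ; apply: eq_expect => t.
rewrite expect_bind /=; under eq_expect do rewrite big_cons.
by rewrite expectZ ih mulrC.
Qed.

Lemma prob_mapM A T (f : A -> prog B X T) (s : seq A) a0 t0 (P : A -> T -> Prop) a :
  0 <= a -> (forall x, prob mu (fun t => ~ P x t) (f x) <= a) ->
  prob mu (fun r => ~ (forall i, (i < size s)%N -> P (nth a0 s i) (nth t0 r i)))
    (mapM f s) <= (size s)%:R * a.
Proof.
move=> a0' fa; elim: s => [|x s ih] /=.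
  by rewrite mul0r /prob /= asboolF //; apply; case.
rewrite mulrSr mulrDl mul1r addrC.
apply: prob_bind (fa x) _ => //; first by rewrite mulr_ge0.
move=> t Pxt; rewrite /prob expect_bind /=.
apply: le_trans ih; apply: sub_prob => // r nP H.
by apply: nP => -[//|i]; apply: H.
Qed.

End Iteration.
End Programs.

(** * Programs as algorithms *)

Section Leaves.
Variables (R : realType) (B : Type) (X : finType) (T : Type).
Variables (mu : B -> X -> R) (b0 : B) (x0 : X).
Hypothesis mu_ge0 : forall b x, 0 <= mu b x.
Hypothesis mu_sum1 : forall b, \sum_x mu b x = 1.
Implicit Types (p : prog B X T) (h : seq X).

(** Total on histories: answers received past a leaf are dropped. This is why [mem_leaves] has to
    demand that no proper prefix has reached a leaf. *)
Fixpoint residual p h : prog B X T :=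
  match h, p with
  | x :: h', Ask _ k => residual (k x) h'
  | _, _ => p
  end.

Definition is_ret p := if p is Ret _ then true else false.
Definition next_query p := if p is Ask b _ then b else b0.

Fixpoint leaves p : seq (seq X) :=
  match p with
  | Ret _ => [:: [::]]
  | Ask _ k => flatten [seq [seq x :: h | h <- leaves (k x)] | x <- enum X]
  end.

(** The left side is [complete_run] of the compiled algorithm. Complete runs thus form a finite set,
    and the sum over all answer lists becomes a finite sum. *)
Lemma mem_leaves p h :
  (forall i, (i < size h)%N -> ~~ is_ret (residual p (take i h))) /\
    is_ret (residual p h) <-> h \in leaves p.
Proof.
elim: p h => [t|b k ih] [|x h] /=; rewrite ?inE.
- by split.
- by split=> // -[/(_ 0%N isT)].
- by split=> [[]//|/flatten_mapP[x _ /mapP[]]].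
have -> : (x :: h \in flatten [seq [seq y :: h0 | h0 <- leaves (k y)]
    | y <- enum X]) = (h \in leaves (k x)).
  apply/flatten_mapP/idP => [[y _ /mapP[h' kh' [-> ->//]]]|kh].
  by exists x; [rewrite mem_enum|apply/mapP; exists h].
rewrite -ih; split=> -[H1 H2]; split=> // i ii; first exact: (H1 i.+1).
by case: i ii => // i ii; apply: H1.
Qed.

Lemma uniq_leaves p : uniq (leaves p).
Proof.
elim: p => //= b k ih; elim: (enum X) (enum_uniq X) => //= x s IH /andP[xs us].
rewrite cat_uniq IH // andbT (map_inj_uniq (_ : injective (cons x))); last by move=> ? ? [].
rewrite ih /=; apply/hasPn => h /flatten_mapP[y ys /mapP[h' _ ->]].
by apply/negP => /mapP[h'' _ [yx _]]; rewrite -yx ys in xs.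
Qed.

Definition transcript_prob p h : R :=
  \prod_(i < size h) mu (next_query (residual p (take i h))) (nth x0 h i).

Lemma transcript_prob_ge0 p h : 0 <= transcript_prob p h.
Proof. exact: prodr_ge0. Qed.

Lemma sum_leaves_Ask b k (F : seq X -> R) :
  \sum_(h <- leaves (Ask b k)) transcript_prob (Ask b k) h * F h =
  \sum_x mu b x * \sum_(h <- leaves (k x)) transcript_prob (k x) h * F (x :: h).
Proof.
rewrite /= big_flatten big_map big_enum /=; apply: eq_bigr => x _.
rewrite big_map mulr_sumr; apply: eq_bigr => h _.
by rewrite /transcript_prob /= big_ord_recl /= mulrA.
Qed.

(** The bridge between the two semantics, sums over answer lists and recursion on the tree: the
    factor of the first answer splits off. *)
Lemma sum_leaves p (F : prog B X T -> R) :
  \sum_(h <- leaves p) transcript_prob p h * F (residual p h) =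
  expect mu (fun t => F (Ret t)) p.
Proof.
elim: p => [t|b k ih]; first by rewrite big_seq1 /transcript_prob big_ord0 mul1r.
by rewrite sum_leaves_Ask; apply: eq_bigr => x _; rewrite ih.
Qed.

Lemma sum_leaves_size p :
  \sum_(h <- leaves p) transcript_prob p h * (size h)%:R = calls mu p.
Proof.
elim: p => [t|b k ih]; first by rewrite big_seq1 mulr0.
rewrite sum_leaves_Ask /= -[X in _ = X + _](mu_sum1 b) -big_split /=; apply: eq_bigr => x _.
rewrite -{2}[mu b x]mulr1 -mulrDr -ih; congr (_ * _).
under eq_bigr do rewrite mulrSr mulrDr mulr1.
rewrite big_split addrC; congr (_ + _) => /=.
under eq_bigr do rewrite -[transcript_prob _ _]mulr1.
by rewrite (sum_leaves (k x) (fun=> 1)) expect_const.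
Qed.

End Leaves.

(** An algorithm must keep its queries in range at every seed and history, even after halting, where
    [next_query] is a default value. Clipping ensures this by construction and leaves legal queries
    unchanged. *)
Definition clip (R : realType) (bmin bmax b : R) := Num.max bmin (Num.min bmax b).

Lemma clip_in (R : realType) (bmin bmax b : R) :
  bmin <= bmax -> clip bmin bmax b \in `[bmin, bmax].
Proof. by move=> bb; rewrite in_itv /= /clip le_max lexx ge_max bb ge_min lexx. Qed.

Lemma clip_id (R : realType) (bmin bmax b : R) :
  bmin <= b <= bmax -> clip bmin bmax b = b.
Proof. by case/andP=> lb ub; rewrite /clip min_r // max_r. Qed.

(** With a single bit as seed and its discrete sigma-algebra, every measurability obligation is
    trivial. *)
Lemma measurable_from_bool d (T : measurableType d) (f : bool -> T) :
  measurable_fun [set: bool] f.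
Proof. by []. Qed.

Section Compilation.
Variables (R : realType) (n : nat) (bmin bmax : R) (bb : bmin <= bmax) (p : R).
Local Notation vec := ('I_n.+1 -> R).
Variable P : bool -> prog R 'I_n.+1 (vec * vec).

Definition output (q : prog R 'I_n.+1 (vec * vec)) : vec * vec :=
  if q is Ret t then t else (fun=> 0, fun=> 0).

(** The random bit chooses between two programs that are themselves deterministic apart from the
    oracle; it serves to give up at random when gamma > 1/2. *)
Definition compiled : algorithm n bmin bmax :=
  @Algorithm R n bmin bmax _ bool (bernoulli_prob p)
    (fun w h => is_ret (residual (P w) h))
    (fun w h => clip bmin bmax (next_query 0 (residual (P w) h)))
    (fun w h => (output (residual (P w) h)).1)
    (fun w h => (output (residual (P w) h)).2)
    (fun w h => clip_in _ bb)
    (fun h => measurable_from_bool _) (fun h => measurable_from_bool _)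
    (fun h x => measurable_from_bool _) (fun h x => measurable_from_bool _).

Variable c : 'I_n.+1 -> R.
Let mu (b : R) := gibbs c (clip bmin bmax b).
Hypothesis mu_ge0 : forall b x, 0 <= mu b x.
Hypothesis mu_sum1 : forall b, \sum_x mu b x = 1.
Hypothesis p01 : 0 <= p <= 1.

Lemma run_integralE (F : bool -> seq 'I_n.+1 -> R) : (forall w h, 0 <= F w h) ->
  @run_integral _ _ _ _ compiled c (fun w h => (F w h)%:E) =
  (p * \sum_(h <- leaves (P true)) transcript_prob mu 0 ord0 (P true) h * F true h +
   (1 - p) * \sum_(h <- leaves (P false)) transcript_prob mu 0 ord0 (P false) h * F false h)%:E.
Proof.
move=> F0; rewrite /run_integral.
have E w : (\esum_(h in @complete_run _ _ _ _ compiled w)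
    ((@answers_prob _ _ _ _ compiled c w h)%:E * (F w h)%:E))%E =
    (\sum_(h <- leaves (P w)) transcript_prob mu 0 ord0 (P w) h * F w h)%:E.
  have -> : @complete_run _ _ _ _ compiled w = [set` leaves (P w)].
    by apply/seteqP; split=> h; [apply: (mem_leaves (P w) h).1|apply: (mem_leaves (P w) h).2].
  rewrite esum_fset; [|exact: finite_seq|]; last first.
    by move=> h _; rewrite -EFinM lee_fin mulr_ge0 // prodr_ge0 // => i _; apply: mu_ge0.
  rewrite -fsbig_seq ?uniq_leaves // -sumEFin.
  by apply: eq_bigr => h _; rewrite EFinM.
under eq_integral do rewrite E.
rewrite integral_bernoulli_prob //; last first.
  by move=> w; rewrite lee_fin sumr_ge0 // => h _; rewrite mulr_ge0 // transcript_prob_ge0.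
Qed.

Lemma success_compiled delta eps :
  @success_probability _ _ _ _ compiled c delta eps =
  (p * prob mu (fun t => count_correct c bmin bmax delta eps t.1 t.2) (P true) +
   (1 - p) * prob mu (fun t => count_correct c bmin bmax delta eps t.1 t.2) (P false))%:E.
Proof.
rewrite /success_probability /run_probability run_integralE; last first.
  by move=> w h; rewrite indicE.
by rewrite /prob -!(sum_leaves mu 0 ord0 _ (fun q => `[<count_correct c bmin bmax delta eps
  (output q).1 (output q).2>]%:R)).
Qed.

Lemma expected_calls_compiled :
  @expected_calls _ _ _ _ compiled c =
  (p * calls mu (P true) + (1 - p) * calls mu (P false))%:E.
Proof.
rewrite /expected_calls /run_probability !run_integralE => [| |w h]; rewrite ?indicE //.
rewrite !sum_leaves_size //.
(* The complete runs have total mass 1, so the infinite penalty for non-termination is multiplied by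
   0. *)
have E w : \sum_(h <- leaves (P w)) transcript_prob mu 0 ord0 (P w) h *
    \1_(fun=> True) h = 1.
  under eq_bigr do rewrite indicE mem_set //.
  by rewrite (sum_leaves mu 0 ord0 (P w) (fun=> 1)) expect_const.
by rewrite !E !mulr1 subrKC subee // mul0e adde0.
Qed.

End Compilation.

(** * Gibbs distributions *)

Section GibbsFacts.
Variables (R : realType) (n : nat) (c : 'I_n.+1 -> R).
Hypothesis cv : valid_counts c.
Implicit Types (b : R) (x y : 'I_n.+1) (k : nat).
Local Notation Z := (partition_fun c).
Local Notation mu := (gibbs c).

Definition mean b (f : 'I_n.+1 -> R) : R := \sum_x mu b x * f x.
Definition mass_ge k b : R := \sum_(x : 'I_n.+1 | (k <= x)%N) mu b x.
Definition mass_lt k b : R := \sum_(x : 'I_n.+1 | (x < k)%N) mu b x.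

Lemma partition_gt0 b : 0 < Z b.
Proof.
case: cv => c0 [x0 cx0]; rewrite /partition_fun (bigD1 x0) //= ltr_pwDl //.
  by rewrite mulr_gt0 ?expR_gt0 // lt_neqAle eq_sym cx0 c0.
by apply: sumr_ge0 => x _; rewrite mulr_ge0 ?expR_ge0.
Qed.

Lemma gibbs_ge0 b x : 0 <= mu b x.
Proof.
by rewrite /gibbs divr_ge0 ?(ltW (partition_gt0 b)) // mulr_ge0 ?expR_ge0 //; apply: cv.1.
Qed.

Lemma gibbs_gt0 b x : c x != 0 -> 0 < mu b x.
Proof.
move=> cx; rewrite /gibbs divr_gt0 ?partition_gt0 // mulr_gt0 ?expR_gt0 //.
by rewrite lt_neqAle eq_sym cx; apply: cv.1.
Qed.

Lemma gibbs_mul_ge0 b b' x y : 0 <= mu b x * mu b' y.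
Proof. by apply: mulr_ge0; apply: gibbs_ge0. Qed.

Lemma gibbs_sum1 b : \sum_x mu b x = 1.
Proof. by rewrite -mulr_suml divff // gt_eqF // partition_gt0. Qed.

Lemma mean_le b f g : (forall x, f x <= g x) -> mean b f <= mean b g.
Proof. by move=> fg; apply: ler_sum => x _; rewrite ler_wpM2l ?gibbs_ge0. Qed.

Lemma mean_cst b a : mean b (fun=> a) = a.
Proof. by rewrite /mean -mulr_suml gibbs_sum1 mul1r. Qed.

Lemma mass_add k b : mass_lt k b + mass_ge k b = 1.
Proof.
rewrite -(gibbs_sum1 b) (bigID (fun x : 'I_n.+1 => (x < k)%N)) /=.
by congr (_ + _); apply: eq_bigl => x; rewrite -leqNgt.
Qed.

Lemma mass_ge_ge0 k b : 0 <= mass_ge k b.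
Proof. by apply: sumr_ge0 => x _; apply: gibbs_ge0. Qed.

Lemma mass_lt_ge0 k b : 0 <= mass_lt k b.
Proof. by apply: sumr_ge0 => x _; apply: gibbs_ge0. Qed.

(** Counts and partition functions occur equally on both sides, so exchanging the two temperatures
    leaves only an exponential. The odds and peak estimates are termwise applications. *)
Lemma gibbs_swap b b' x y :
  mu b x * mu b' y * expR ((b' - b) * (x%:R - y%:R)) = mu b' x * mu b y.
Proof.
rewrite /gibbs.
have -> : expR ((b' - b) * (x%:R - y%:R)) =
    expR (b' * x%:R) * expR (b * y%:R) / (expR (b * x%:R) * expR (b' * y%:R)).
  by rewrite -!expRD -expRN -expRD; congr expR; ring.
field; rewrite !gt_eqF ?expR_gt0 ?partition_gt0 //.
Qed.

(** For x >= k > y the difference x - y lies between 1 and n, which bounds the growth of the odds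
    from below here and from above in [odds_slow]. The odds are cross-multiplied because either mass
    may vanish. *)
Lemma odds_fast k b b' : b <= b' ->
  expR (b' - b) * (mass_ge k b * mass_lt k b') <= mass_ge k b' * mass_lt k b.
Proof.
move=> bb; rewrite /mass_ge /mass_lt !big_distrlr /= mulr_sumr.
apply: ler_sum => x kx; rewrite mulr_sumr; apply: ler_sum => y yk.
rewrite -(gibbs_swap b b' x y) mulrC ler_wpM2l ?gibbs_mul_ge0 //.
rewrite ler_expR -[leLHS]mulr1 ler_wpM2l ?subr_ge0 // -natrB ?ler1n ?subn_gt0; last 2 first.
  exact: leq_trans yk kx.
exact: (leq_trans (ltnW yk) kx).
Qed.

Lemma odds_slow k b b' : b <= b' ->
  mass_ge k b' * mass_lt k b <= expR (n%:R * (b' - b)) * (mass_ge k b * mass_lt k b').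
Proof.
move=> bb; rewrite /mass_ge /mass_lt !big_distrlr /= mulr_sumr.
apply: ler_sum => x kx; rewrite mulr_sumr; apply: ler_sum => y yk.
rewrite -(gibbs_swap b b' x y) mulrC ler_wpM2r ?gibbs_mul_ge0 //.
rewrite ler_expR mulrC ler_wpM2r ?subr_ge0 //.
by rewrite lerBlDr ler_wpDr // ler_nat -ltnS.
Qed.

Lemma partition_mono b b' : b <= b' -> Z b <= Z b'.
Proof.
move=> bb; apply: ler_sum => x _; rewrite ler_wpM2l ?ler_expR ?ler_wpM2r //.
exact: cv.1.
Qed.

Lemma expR_log_ratio b b' : expR (log_partition_ratio c b b') = Z b' / Z b.
Proof. by rewrite /log_partition_ratio lnK // posrE divr_gt0 ?partition_gt0. Qed.

(** Between b and b1 the weight of each x >= 1 grows at least by e^(b1 - b), while the normalisation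
    changes at most by Z(b1)/Z(b0). This is what stops [gallop] at a distance of order q. *)
Lemma mass_ge_tail k b0 b b1 : (0 < k)%N -> b0 <= b -> b <= b1 ->
  mass_ge k b <= expR (log_partition_ratio c b0 b1 - (b1 - b)).
Proof.
move=> k0 b0b bb1; rewrite expRD expR_log_ratio -[leRHS]mul1r -(gibbs_sum1 b1).
rewrite [in leRHS](bigID (fun x : 'I_n.+1 => (k <= x)%N)) /= mulrDl ler_wpDr //.
  by rewrite mulr_ge0 ?sumr_ge0 ?mulr_ge0 ?divr_ge0 ?invr_ge0 ?expR_ge0
    ?(ltW (partition_gt0 _)) // => x _; apply: gibbs_ge0.
rewrite mulr_suml; apply: ler_sum => x kx.
have -> : mu b1 x * (Z b1 / Z b0 * expR (- (b1 - b))) =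
    c x * expR (b1 * x%:R - (b1 - b)) / Z b0.
  by rewrite /gibbs expRD; field; rewrite !gt_eqF ?partition_gt0.
have cx : 0 <= c x by apply: cv.1.
rewrite /gibbs ler_pM ?mulr_ge0 ?invr_ge0 ?expR_ge0 ?(ltW (partition_gt0 _)) //.
  rewrite ler_wpM2l // ler_expR lerBrDr -[X in _ + X]mulr1 -lerBrDl -mulrBl.
  by rewrite ler_wpM2l ?subr_ge0 // ler1n (leq_trans k0 kx).
by rewrite lef_pV2 ?posrE ?partition_gt0 // partition_mono.
Qed.

(** Passing from b' up to b favours x over every y <= x; sum this over those y, whose total mass at
    b' is at most 1. *)
Lemma peak_left x b b' : b' <= b ->
  mu b' x * (\sum_(y : 'I_n.+1 | (y <= x)%N) mu b y) <= mu b x.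
Proof.
move=> bb; rewrite mulr_sumr -[leRHS]mulr1 -(gibbs_sum1 b').
rewrite [in leRHS](bigID (fun y : 'I_n.+1 => (y <= x)%N)) /= mulrDr ler_wpDr //.
  by rewrite mulr_ge0 ?gibbs_ge0 ?sumr_ge0 // => y _; apply: gibbs_ge0.
rewrite mulr_sumr; apply: ler_sum => y yx.
rewrite -(gibbs_swap b b' x y) ler_piMr ?gibbs_mul_ge0 //.
by rewrite -[leRHS]expR0 ler_expR mulr_le0_ge0 ?subr_le0 ?subr_ge0 ?ler_nat.
Qed.

Lemma peak_right x b b' : b <= b' ->
  mu b' x * (\sum_(y : 'I_n.+1 | (x <= y)%N) mu b y) <= mu b x.
Proof.
move=> bb; rewrite mulr_sumr -[leRHS]mulr1 -(gibbs_sum1 b').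
rewrite [in leRHS](bigID (fun y : 'I_n.+1 => (x <= y)%N)) /= mulrDr ler_wpDr //.
  by rewrite mulr_ge0 ?gibbs_ge0 ?sumr_ge0 // => y _; apply: gibbs_ge0.
rewrite mulr_sumr; apply: ler_sum => y xy.
rewrite -(gibbs_swap b b' x y) ler_piMr ?gibbs_mul_ge0 //.
by rewrite -[leRHS]expR0 ler_expR mulr_ge0_le0 ?subr_le0 ?subr_ge0 ?ler_nat.
Qed.

(** * Balanced temperatures and acceptance ratios *)

Variables (bmin bmax : R).
Hypothesis bb : bmin <= bmax.

(** A small [mass_ge] is excused only at [bmax], where that mass is largest, and a small [mass_lt]
    only at [bmin]. An excused bound is needed only for temperatures beyond that end, and there are
    none. *)
Definition balanced k b : Prop :=
  [/\ bmin <= b <= bmax, b = bmax \/ 4^-1 <= mass_ge k b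
    & b = bmin \/ 4^-1 <= mass_lt k b].

Lemma sum_le_ge_mass_lt x b :
  mass_lt x b <= \sum_(y : 'I_n.+1 | (y <= x)%N) mu b y.
Proof.
rewrite /mass_lt big_mkcond [leRHS]big_mkcond /=; apply: ler_sum => y _.
by case: ltngtP => // _; apply: gibbs_ge0.
Qed.

Lemma gibbs_le_balanced x b b' : balanced x b -> bmin <= b' <= bmax ->
  mu b' x <= 4 * mu b x.
Proof.
case=> /andP[lb ub] Hr Hl /andP[lb' ub']; rewrite mulrC -ler_pdivrMr //.
have [bb'|bb'] := leP b b'.
  case: Hr => [bE|Hr]; last first.
    by apply: le_trans (peak_right x bb'); rewrite ler_wpM2l ?gibbs_ge0.
  have -> : b' = b by apply/eqP; rewrite eq_le bb' bE ub'.
  by rewrite ler_piMr ?gibbs_ge0 // invf_le1 // ler1n.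
case: Hl => [bE|Hl]; first by move: bb'; rewrite bE ltNge lb'.
apply: le_trans (peak_left x (ltW bb')); rewrite ler_wpM2l ?gibbs_ge0 //.
by apply: le_trans (sum_le_ge_mass_lt x b).
Qed.

Lemma max_gibbs_balanced x b : c x != 0 -> balanced x b ->
  0 < max_gibbs c bmin bmax x <= 4 * mu b x.
Proof.
move=> cx bx.
have ubd : ubound [set mu b' x | b' in `[bmin, bmax]] (4 * mu b x).
  by move=> _ [b' /= b'I <-]; apply: gibbs_le_balanced => //; rewrite in_itv in b'I.
have inA : [set mu b' x | b' in `[bmin, bmax]] (mu bmin x).
  by exists bmin => //=; rewrite in_itv /= lexx bb.
apply/andP; split; last by apply: ge_sup => //; exists (mu bmin x).
apply: lt_le_trans (gibbs_gt0 bmin cx) _; apply: ub_le_sup => //.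
by exists (4 * mu b x).
Qed.

(* Bennett's acceptance function: the ratio of its means at two temperatures
   gives the ratio of the partition functions. *)
Definition acceptance b b' (i : nat) x : R :=
  Num.min 1 (expR ((b' - b) * (x%:R - i%:R))).

Lemma acceptance01 b b' i x : 0 <= acceptance b b' i x <= 1.
Proof. by rewrite /acceptance le_min ler01 expR_ge0 ge_min lexx. Qed.

(** Termwise, both sides equal c_x times the minimum of e^(b' x) and e^(b x + (b' - b) i), which
    does not depend on the direction of the move. *)
Lemma partition_acceptance b b' i :
  Z b' * mean b' (acceptance b' b i) =
  Z b * mean b (acceptance b b' i) * expR ((b' - b) * i%:R).
Proof.
rewrite /mean !mulr_sumr mulr_suml; apply: eq_bigr => x _.
rewrite /gibbs; set A := expR (b' * _); set D := expR (b * _); set C := expR (_ * i%:R).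
have -> : Z b' * (c x * A / Z b' * acceptance b' b i x) = c x * (A * acceptance b' b i x).
  by field; rewrite gt_eqF // partition_gt0.
have -> : Z b * (c x * D / Z b * acceptance b b' i x) * C =
    c x * (C * D * acceptance b b' i x).
  by field; rewrite gt_eqF // partition_gt0.
congr (_ * _); rewrite /acceptance /A /C /D !minr_pMr ?mulr_ge0 ?expR_ge0 // !mulr1.
rewrite -!expRD minC; congr (Num.min (expR _) (expR _)); ring.
Qed.

(** The acceptance function is 1 on {X >= i} or on {X <= i}, according to the sign of the
    temperature difference. A noisy search may return the two temperatures in the wrong order, so
    both orders are treated; a strict order rules out the excuse of lying at the relevant end. *)
Lemma mean_acceptance_ge b b' i : balanced i b -> balanced i.+1 b' ->
  4^-1 <= mean b (acceptance b b' i) /\ 4^-1 <= mean b' (acceptance b' b i).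
Proof.
have key (P : pred 'I_n.+1) d d' : (forall x, P x -> 0 <= (d' - d) * (x%:R - i%:R)) ->
    \sum_(x | P x) mu d x <= mean d (acceptance d d' i).
  move=> Px; rewrite big_mkcond /=; apply: ler_sum => x _; case: ifP => [/Px xi|_].
    by rewrite /acceptance min_l ?mulr1 // -[leLHS]expR0 ler_expR.
  by rewrite mulr_ge0 ?gibbs_ge0 // (andP (acceptance01 _ _ _ _)).1.
have ge d d' : d <= d' -> 4^-1 <= mass_ge i d -> 4^-1 <= mean d (acceptance d d' i).
  move=> dd /le_trans; apply; apply: key => x ix.
  by rewrite mulr_ge0 ?subr_ge0 ?ler_nat.
have lt d d' : d' <= d -> 4^-1 <= mass_lt i.+1 d -> 4^-1 <= mean d (acceptance d d' i).
  move=> dd /le_trans; apply; apply: key => x ix.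
  by rewrite mulr_le0 ?subr_le0 ?ler_nat.
have mono_ge d : mass_ge i.+1 d <= mass_ge i d.
  rewrite /mass_ge big_mkcond [leRHS]big_mkcond /=; apply: ler_sum => y _.
  by case: ltngtP => // _; apply: gibbs_ge0.
have mono_lt d : mass_lt i d <= mass_lt i.+1 d.
  rewrite /mass_lt big_mkcond [leRHS]big_mkcond /=; apply: ler_sum => y _.
  by rewrite ltnS; case: ltngtP => // _; apply: gibbs_ge0.
move=> [/andP[b1 b2] Hr Hl] [/andP[b1' b2'] Hr' Hl'].
have [lt_bb|lt_bb|<-] := ltgtP b b'.
- split.
    apply: ge; first exact: ltW.
    by case: Hr => // bE; move: lt_bb; rewrite bE ltNge b2'.
  apply: lt; first exact: ltW.
  by case: Hl' => // bE; move: lt_bb; rewrite bE ltNge b1.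
- split.
    apply: lt; first exact: ltW.
    case: Hl => [bE|/le_trans]; last exact.
    by move: lt_bb; rewrite bE ltNge b1'.
  apply: ge; first exact: ltW.
  case: Hr' => [bE|/le_trans]; last exact.
  by move: lt_bb; rewrite bE ltNge b2.
- have -> : mean b (acceptance b b i) = 1.
    rewrite -(gibbs_sum1 b); apply: eq_bigr => x _.
    by rewrite /acceptance subrr mul0r expR0 minxx mulr1.
  by split; rewrite invf_le1 // ler1n.
Qed.

End GibbsFacts.

(** * Majority votes *)

Section Voting.
Variables (R : realType) (B : Type) (X : finType).
Variable mu : B -> X -> R.
Hypothesis mu_ge0 : forall b x, 0 <= mu b x.
Hypothesis mu_sum1 : forall b, \sum_x mu b x = 1.

Definition samples (m : nat) (b : B) : prog B X (seq X) :=
  mapM (@ask B X) (nseq m b).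

Lemma calls_samples m b : calls mu (samples m b) <= m%:R.
Proof.
rewrite -[leRHS]mulr1 -[in leRHS](size_nseq m b).
by apply: calls_mapM => // x; rewrite calls_ask.
Qed.

Lemma expect_expR_samples (f : X -> R) m b :
  expect mu (fun s => expR (\sum_(x <- s) f x)) (samples m b) =
  (\sum_x mu b x * expR (f x)) ^+ m.
Proof.
rewrite -expect_ask -(expect_mapM_nseq _ _ b m (fun x => expR (f x))).
by apply: eq_expect => s; rewrite expR_sum.
Qed.

Lemma signed_count (A : pred X) (s : seq X) (a : R) :
  \sum_(x <- s) (if A x then a else - a) = a * ((2 * count A s)%:R - (size s)%:R).
Proof.
elim: s => [|x s ih]; first by rewrite big_nil subr0 mulr0.
rewrite big_cons ih /= -[in RHS]addn1 mulnDr !natrD; case: (A x) => /=; ring.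
Qed.

(* Chernoff bound for a majority vote whose single ballots are already biased by
   a factor exponential in [l]. *)
Lemma majority_wrong (A : pred X) b m l : 0 <= l ->
  \sum_(x | A x) mu b x <= 2^-1 * expR (- (l / 8)) * \sum_(x | ~~ A x) mu b x ->
  prob mu (fun s => (size s <= 2 * count A s)%N) (samples m b) <=
    expR (- (m%:R * (1 + l) / 320)).
Proof.
move=> l0; set P := \sum_(x | A x) _; set Q := \sum_(x | ~~ A x) _ => PQ.
have PQ1 : P + Q = 1 by rewrite -(mu_sum1 b) [in RHS](bigID A).
have P0 : 0 <= P by apply: sumr_ge0.
have Q0 : 0 <= Q by apply: sumr_ge0.
have main a : 0 <= a -> expR a * P + expR (- a) * Q <= expR (- ((1 + l) / 320)) ->
    prob mu (fun s => (size s <= 2 * count A s)%N) (samples m b) <=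
    expR (- (m%:R * (1 + l) / 320)).
  move=> a0 H.
  apply: le_trans (markov_exp mu_ge0 (f := fun s => \sum_(x <- s)
    (if A x then a else - a)) _ _) _.
    by move=> s As; rewrite signed_count mulr_ge0 // subr_ge0 ler_nat.
  rewrite expect_expR_samples -mulrA -mulrN expRM_natl lerXn2r ?nnegrE ?expR_ge0 //.
    by apply: sumr_ge0 => x _; rewrite mulr_ge0 ?expR_ge0.
  apply: le_trans H; rewrite (bigID A) /=.
  by rewrite le_eqVlt; apply/orP; left; apply/eqP; congr (_ + _); rewrite mulr_sumr;
    apply: eq_bigr => x; [move=> ->|move=> /negbTE ->]; rewrite mulrC.
(* For small [l] the bias [P <= 3^-1] is enough: at a = ln (3/2) the generating function is at most
   17/18, which is below 1 - 17/320. This fixes the constant 320. *)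
have [l16|l16] := leP l 16.
  apply: (main (ln (3 / 2))); first by apply: ln_ge0; lra.
  rewrite expRN lnK ?posrE; last by lra.
  have E1 : expR (- (l / 8)) <= 1 by rewrite expR_le1; lra.
  have P3 : P <= 2^-1 * Q.
    by apply: le_trans PQ _; rewrite ler_wpM2r // ler_piMr //; lra.
  apply: le_trans (expR_ge1Dx _); rewrite invf_div; lra.
(* The tilt l/16 is half of the bias exponent l/8 and makes both terms of order e^(-l/16); since l >
   16 the factor 3/2 is absorbed. *)
apply: (main (l / 16)); first by lra.
have E : expR (l / 16) * P <= 2^-1 * expR (- (l / 16)).
  have -> : expR (- (l / 16)) = expR (l / 16) * expR (- (l / 8)).
    by rewrite -expRD; congr expR; lra.
  rewrite mulrCA ler_wpM2l ?expR_ge0 //; apply: le_trans PQ _.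
  by rewrite ler_piMr ?mulr_ge0 ?expR_ge0 //; lra.
have E2 : expR (- (l / 16)) * Q <= expR (- (l / 16)).
  by rewrite ler_piMr ?expR_ge0 //; lra.
have E3 : 3 / 2 <= expR (l / 16 - (1 + l) / 320).
  by apply: le_trans (expR_ge1Dx _); lra.
have -> : - ((1 + l) / 320) = (l / 16 - (1 + l) / 320) + - (l / 16) by lra.
rewrite expRD; apply: le_trans (lerD E E2) _.
have -> : 2^-1 * expR (- (l / 16)) + expR (- (l / 16)) = 3 / 2 * expR (- (l / 16)) by lra.
by rewrite ler_wpM2r ?expR_ge0.
Qed.

End Voting.

(** * Noisy search for a balanced temperature *)

Section Search.
Variables (R : realType) (n : nat) (bmin bmax L : R).
Hypothesis bb : bmin <= bmax.
Hypothesis n0 : (0 < n)%N.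
Hypothesis L0 : 0 <= L.
Local Notation prg := (prog R 'I_n.+1).
Implicit Types (a b d l : R) (k m F : nat).

Definition vote_high k b m : prg bool :=
  bind (samples _ m b) (fun s => Ret (size s <= 2 * count (fun x : 'I_n.+1 => (k <= x)%N) s)%N).

(** One ballot contributes an error exponent proportional to 1 + l, so wide brackets need few. One
    of the two extra ballots rounds up; the other turns the total exponent from L into at least L +
    l. *)
Definition ballots l : nat := (Num.truncn (L / (1 + l))).+2.

(* Either half is enlarged by 1/8 of the bracket: a vote is harmful only if the
   crossing is at distance more than [(b - a) / 8] from the midpoint, and then a
   single ballot errs with probability at most [expR (- (b - a) / 8)]. *)
Fixpoint bisect k F a b : prg R :=
  if F is F'.+1 then
    if b - a <= (3 * n%:R)^-1 then Ret a else
      bind (vote_high k ((a + b) / 2) (ballots (b - a))) (fun high =>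
        if high then bisect k F' a (a + 5 / 8 * (b - a))
        else bisect k F' (b - 5 / 8 * (b - a)) b)
  else Ret a.

(** A single sample decides. A low answer at bmax - d keeps the bracket down to bmax - 2d, so it
    does harm only if the crossing is more than about d to the left of the query, and is then
    exponentially unlikely. A high answer just doubles [d]. *)
Fixpoint gallop k F G d : prg R :=
  if G is G'.+1 then
    if bmax - bmin <= 2 * d then bisect k F bmin bmax else
      bind (ask _ (bmax - d)) (fun x : 'I_n.+1 =>
        if (k <= x)%N then gallop k F G' (2 * d)
        else bisect k F (bmax - 2 * d) bmax)
  else bisect k F bmin bmax.

Lemma bisectS k F a b : bisect k F.+1 a b =
  if b - a <= (3 * n%:R)^-1 then Ret a else
    bind (vote_high k ((a + b) / 2) (ballots (b - a))) (fun high =>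
      if high then bisect k F a (a + 5 / 8 * (b - a))
      else bisect k F (b - 5 / 8 * (b - a)) b).
Proof. by []. Qed.

Lemma gallopS k F G d : gallop k F G.+1 d =
  if bmax - bmin <= 2 * d then bisect k F bmin bmax else
    bind (ask _ (bmax - d)) (fun x : 'I_n.+1 =>
      if (k <= x)%N then gallop k F G (2 * d)
      else bisect k F (bmax - 2 * d) bmax).
Proof. by []. Qed.

(** Testing both ends first provides the invariant of the bisection: mass at least 1/3 below [k] at
    the left end and at least 1/3 above at the right end. If a test stops the search, the end itself
    is balanced. *)
Definition search F G d k : prg R :=
  bind (vote_high k bmin (ballots 0)) (fun high =>
    if high then Ret bmin else
      bind (vote_high k bmax (ballots 0)) (fun high' =>
        if high' then gallop k F G d else Ret bmax)).

Variable c : 'I_n.+1 -> R.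
Hypothesis cv : valid_counts c.
Let mu b := gibbs c (clip bmin bmax b).

Let mu_ge0 b x : 0 <= mu b x.
Proof. exact: gibbs_ge0. Qed.

Let mu_sum1 b : \sum_x mu b x = 1.
Proof. exact: gibbs_sum1. Qed.

Let muE b : bmin <= b <= bmax -> mu b = gibbs c b.
Proof. by move=> bI; rewrite /mu clip_id. Qed.

Let n1 : (1 : R) <= n%:R.
Proof. by rewrite ler1n. Qed.

Lemma ballots_le l : 0 <= l -> (ballots l)%:R <= L / (1 + l) + 2.
Proof.
move=> l0; have q0 : 0 <= L / (1 + l) by rewrite divr_ge0 //; lra.
rewrite /ballots -addn2 natrD lerD2r.
by have /andP[] := truncn_itv q0.
Qed.

Lemma ballots_ge l : 0 <= l -> L + l <= (ballots l)%:R * (1 + l).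
Proof.
move=> l0; have := truncnS_gt (L / (1 + l)).
rewrite ltr_pdivrMr; last by lra.
by rewrite /ballots -addn1 natrD mulrDl mul1r; lra.
Qed.

Definition vote_error l : R := expR (- ((L + l) / 320)).

Lemma vote_error_ge0 l : 0 <= vote_error l.
Proof. exact: expR_ge0. Qed.

Lemma ballots_error l : 0 <= l ->
  expR (- ((ballots l)%:R * (1 + l) / 320)) <= vote_error l.
Proof. by move=> l0; rewrite ler_expR; have := ballots_ge l0; lra. Qed.

(* The bracket lengths of a bisection decrease geometrically, so that errors
   bounded by [tick / l] sum to a multiple of [tick] over the last length. *)
Variable tick : R.
Hypothesis vote_error_tick : forall l, 0 < l -> vote_error l <= tick / l.
Hypothesis tick_ge0 : 0 <= tick.

Lemma prob_vote_high k b m (Q : bool -> Prop) :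
  prob mu Q (vote_high k b m) = prob mu (fun s => Q (size s <=
    2 * count (fun x : 'I_n.+1 => (k <= x)%N) s)%N) (samples _ m b).
Proof. by rewrite /prob expect_bind. Qed.

Lemma vote_high_wrong k b l : bmin <= b <= bmax -> 0 <= l ->
  mass_ge c k b <= 2^-1 * expR (- (l / 8)) * mass_lt c k b ->
  prob mu (fun high => high = true) (vote_high k b (ballots l)) <=
    vote_error l.
Proof.
move=> bI l0 H; apply: le_trans (ballots_error l0).
rewrite prob_vote_high.
apply: (majority_wrong mu_ge0 mu_sum1 (A := fun x : 'I_n.+1 => (k <= x)%N) _ l0).
rewrite muE //; apply: le_trans H _.
by rewrite /mass_lt le_eqVlt; apply/orP; left; apply/eqP; congr (_ * _);
  apply: eq_bigl => x; rewrite -ltnNge.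
Qed.

Lemma vote_low_wrong k b l : bmin <= b <= bmax -> 0 <= l ->
  mass_lt c k b <= 2^-1 * expR (- (l / 8)) * mass_ge c k b ->
  prob mu (fun high => high = false) (vote_high k b (ballots l)) <=
    vote_error l.
Proof.
move=> bI l0 H; apply: le_trans (ballots_error l0).
rewrite prob_vote_high.
apply: le_trans (majority_wrong mu_ge0 mu_sum1 (A := fun x : 'I_n.+1 => (x < k)%N) _ l0 _).
  apply: sub_prob => // s.
  have := count_predC (fun x : 'I_n.+1 => (k <= x)%N) s.
  have -> : count (predC (fun x : 'I_n.+1 => (k <= x)%N)) s =
    count (fun x : 'I_n.+1 => (x < k)%N) s by apply: eq_count => x /=; rewrite -ltnNge.
  by move=> <- /negbT; rewrite -ltnNge !mul2n -!addnn ltn_add2l leq_add2r => /ltnW.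
rewrite muE //; apply: le_trans H _.
by rewrite /mass_ge le_eqVlt; apply/orP; left; apply/eqP; congr (_ * _);
  apply: eq_bigl => x; rewrite -leqNgt.
Qed.

Lemma calls_vote_high k b m : calls mu (vote_high k b m) <= m%:R.
Proof.
apply: le_trans (calls_bind_le mu_ge0 mu_sum1 (a := 0) _ _) _ => //.
by rewrite addr0 calls_samples.
Qed.

(** At b the odds of {X >= k} are at least 1/2; across the bracket they change at most by e^(1/3) <=
    3/2, so at a they are at least 1/3, that is, mass at least 1/4. The gap between 1/3 and 1/4
    dictates the width 1/(3n). *)
Lemma balanced_bracket k a b : bmin <= a -> a <= b -> b <= bmax ->
  b - a <= (3 * n%:R)^-1 ->
  3^-1 <= mass_lt c k a -> 3^-1 <= mass_ge c k b -> balanced c bmin bmax k a.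
Proof.
move=> la ab ub ab3 Ha Hb; have := odds_slow cv k ab.
have E : expR (n%:R * (b - a)) <= 3 / 2.
  have nab : n%:R * (b - a) <= 3^-1.
    apply: le_trans (ler_wpM2l (ler0n _ _) ab3) _; rewrite invfM mulrCA divff ?mulr1 //.
    by rewrite pnatr_eq0 -lt0n.
  have := expR_ge1Dx (- (n%:R * (b - a))); rewrite expRN => H.
  have : 2 / 3 <= 1 / expR (n%:R * (b - a)) by rewrite div1r; lra.
  by rewrite ler_pdivlMr ?expR_gt0 //; lra.
rewrite /balanced; have := mass_add cv k a; have := mass_add cv k b.
have := mass_ge_ge0 cv k a; have := mass_lt_ge0 cv k b.
move: (mass_ge c k a) (mass_lt c k a) (mass_ge c k b) (mass_lt c k b) Ha Hb E => p q p' q'.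
move=> Ha Hb E q'0 p0 E' Ea H; split; first by apply/andP; split=> //; lra.
  right; suff Hq : q <= 3 * p by lra.
  have H1 : p' * q <= 3 / 2 * (p * q').
    by apply: le_trans H _; rewrite ler_wpM2r ?mulr_ge0.
  nra.
by right; lra.
Qed.

(** If the kept part violates the invariant at its new end, the odds there are below 1/2; the
    midpoint is (b - a)/8 away, so a ballot for that part has odds at most e^(-(b - a)/8)/2. The
    factor 2 adds the two directions. *)
Lemma bisect_vote_wrong k a b : bmin <= a -> a <= b -> b <= bmax ->
  prob mu (fun high => ~ (if high then 3^-1 <= mass_ge c k (a + 5 / 8 * (b - a))
     else 3^-1 <= mass_lt c k (b - 5 / 8 * (b - a))))
     (vote_high k ((a + b) / 2) (ballots (b - a))) <= 2 * vote_error (b - a).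
Proof.
move=> la ab ub; have l0 : 0 <= b - a by lra.
have mI : bmin <= (a + b) / 2 <= bmax by apply/andP; split; lra.
apply: le_trans (sub_prob mu_ge0 (Q := fun high : bool =>
  (high = true /\ mass_ge c k (a + 5 / 8 * (b - a)) < 3^-1) \/
  (high = false /\ mass_lt c k (b - 5 / 8 * (b - a)) < 3^-1)) _ _) _.
  by case=> /negP; rewrite -ltNge; [left|right].
apply: le_trans (prob_or mu_ge0 _ _ _) _; rewrite [leRHS]mulr_natl [leRHS]mulr2n; apply: lerD.
- have [H|H] := ltP (mass_ge c k (a + 5 / 8 * (b - a))) 3^-1; last first.
    apply: le_trans (sub_prob mu_ge0 (Q := fun=> False) _ _) _.
      by move=> t [].
    by rewrite /prob asboolF // expect_const // vote_error_ge0.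
  apply: le_trans (sub_prob mu_ge0 (Q := fun high : bool => high = true) _ _) _; first by move=> ? [].
  apply: vote_high_wrong => //.
  have := @odds_fast _ _ _ cv k ((a + b) / 2) (a + 5 / 8 * (b - a)).
  have -> : a + 5 / 8 * (b - a) - (a + b) / 2 = (b - a) / 8 by lra.
  have -> : ((a + b) / 2 <= a + 5 / 8 * (b - a)) = true by lra.
  move=> /(_ isT) O; have := mass_add cv k (a + 5 / 8 * (b - a)) => S.
  rewrite expRN mulrAC ler_pdivlMr ?expR_gt0 //.
  have G0 := mass_ge_ge0 cv k ((a + b) / 2).
  have G1 := mass_lt_ge0 cv k ((a + b) / 2).
  have O1 : expR ((b - a) / 8) * (mass_ge c k ((a + b) / 2) * (2 / 3)) <=
      3^-1 * mass_lt c k ((a + b) / 2).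
    apply: le_trans (le_trans O _).
      by rewrite ler_wpM2l ?expR_ge0 // ler_wpM2l //; lra.
    by rewrite ler_wpM2r //; lra.
  lra.
- have [H|H] := ltP (mass_lt c k (b - 5 / 8 * (b - a))) 3^-1; last first.
    apply: le_trans (sub_prob mu_ge0 (Q := fun=> False) _ _) _.
      by move=> t [].
    by rewrite /prob asboolF // expect_const // vote_error_ge0.
  apply: le_trans (sub_prob mu_ge0 (Q := fun high : bool => high = false) _ _) _; first by move=> ? [].
  apply: vote_low_wrong => //.
  have := @odds_fast _ _ _ cv k (b - 5 / 8 * (b - a)) ((a + b) / 2).
  have -> : (a + b) / 2 - (b - 5 / 8 * (b - a)) = (b - a) / 8 by lra.
  have -> : (b - 5 / 8 * (b - a) <= (a + b) / 2) = true by lra.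
  move=> /(_ isT) O; have := mass_add cv k (b - 5 / 8 * (b - a)) => S.
  rewrite expRN mulrAC ler_pdivlMr ?expR_gt0 //.
  have G0 := mass_lt_ge0 cv k ((a + b) / 2).
  have G1 := mass_ge_ge0 cv k ((a + b) / 2).
  have O1 : expR ((b - a) / 8) * (2 / 3 * mass_lt c k ((a + b) / 2)) <=
      mass_ge c k ((a + b) / 2) * 3^-1.
    apply: le_trans (le_trans O _).
      by rewrite ler_wpM2l ?expR_ge0 // ler_wpM2r //; lra.
    by rewrite ler_wpM2l //; lra.
  lra.
Qed.

(** The potential (5/3)/l grows by exactly 1/l when l becomes 5l/8, so the errors telescope. It
    reaches 8n at l = 5/(24n), which is 5/8 of the stopping width and hence the shortest bracket
    that can arise. *)
Lemma bisect_wrong_long k F a b : bmin <= a -> b <= bmax ->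
  5 / (24 * n%:R) <= b - a -> (b - a) * (5 / 8) ^+ F <= (3 * n%:R)^-1 ->
  3^-1 <= mass_lt c k a -> 3^-1 <= mass_ge c k b ->
  prob mu (fun t => ~ balanced c bmin bmax k t) (bisect k F a b) <=
    2 * tick * (8 * n%:R - 5 / 3 / (b - a)).
Proof.
have n1' := n1; have np : 0 < 24 * n%:R :> R by lra.
elim: F a b => [|F ih] a b la ub l0 lF Ha Hb;
  have l0' : 0 < b - a by [apply: lt_le_trans l0; rewrite divr_gt0];
  have E0 : 0 <= 8 * n%:R - 5 / 3 / (b - a) by
    [rewrite subr_ge0 ler_pdivrMr //; move: l0; rewrite ler_pdivrMr //; lra];
  have E1 : 0 <= 2 * tick * (8 * n%:R - 5 / 3 / (b - a)) by
    [rewrite !mulr_ge0].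
  rewrite expr0 mulr1 in lF.
  rewrite /prob /= asboolF //.
  by apply; apply: (@balanced_bracket k a b) => //; lra.
rewrite bisectS; case: ifP => [l3|/negbT]; last rewrite -ltNge => l3.
  rewrite /prob /= asboolF //.
  by apply; apply: (@balanced_bracket k a b) => //; lra.
have -> : 2 * tick * (8 * n%:R - 5 / 3 / (b - a)) =
    2 * (tick / (b - a)) + 2 * tick * (8 * n%:R - 5 / 3 / (5 / 8 * (b - a))).
  by field; lra.
have l1 : 5 / (24 * n%:R) <= 5 / 8 * (b - a).
  have -> : 5 / (24 * n%:R) = 5 / 8 * (3 * n%:R)^-1 :> R by field; lra.
  by rewrite ler_wpM2l ?ltW //; lra.
have ab : a <= b by lra.
have step : 5 / 8 * (b - a) * (5 / 8) ^+ F <= (3 * n%:R)^-1.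
  by apply: le_trans lF; rewrite exprS; lra.
set Fn := 2 * tick * (8 * n%:R - 5 / 3 / (5 / 8 * (b - a))).
have Fn0 : 0 <= Fn.
  apply: mulr_ge0; first exact: mulr_ge0.
  rewrite subr_ge0 ler_pdivrMr; last by lra.
  by move: l1; rewrite ler_pdivrMr //; lra.
apply: le_trans (_ : 2 * vote_error (b - a) + Fn <= _); last first.
  by rewrite lerD2r ler_pM2l // vote_error_tick.
apply: (prob_bind mu_ge0 mu_sum1 Fn0 (bisect_vote_wrong k la ab ub)).
case=> H.
  have lE : a + 5 / 8 * (b - a) - a = 5 / 8 * (b - a) by lra.
  by have := ih a (a + 5 / 8 * (b - a)); rewrite lE; apply=> //; lra.
have lE : b - (b - 5 / 8 * (b - a)) = 5 / 8 * (b - a) by lra.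
by have := ih (b - 5 / 8 * (b - a)) b; rewrite lE; apply=> //; lra.
Qed.

Lemma bisect_wrong k F a b : bmin <= a -> a <= b -> b <= bmax ->
  (b - a) * (5 / 8) ^+ F <= (3 * n%:R)^-1 ->
  3^-1 <= mass_lt c k a -> 3^-1 <= mass_ge c k b ->
  prob mu (fun t => ~ balanced c bmin bmax k t) (bisect k F a b) <=
    16 * n%:R * tick.
Proof.
move=> la ab ub lF Ha Hb; have n1' := n1.
have E0 : 0 <= 16 * n%:R * tick by rewrite !mulr_ge0.
have [l1|l1] := leP (5 / (24 * n%:R)) (b - a).
  apply: le_trans (bisect_wrong_long la ub l1 lF Ha Hb) _.
  have -> : 16 * n%:R * tick = 2 * tick * (8 * n%:R) by ring.
  apply: ler_wpM2l; first exact: mulr_ge0.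
  by rewrite gerBl; apply: divr_ge0; lra.
have l3 : b - a <= (3 * n%:R)^-1.
  apply: le_trans (ltW l1) _.
  have -> : 5 / (24 * n%:R) = 5 / 8 * (3 * n%:R)^-1 :> R by field; lra.
  by rewrite ler_piMl ?invr_ge0 ?mulr_ge0 //; lra.
rewrite /prob; case: F lF => [|F] _; rewrite ?bisectS ?l3 /= asboolF //.
  by apply; apply: (@balanced_bracket k a b).
by apply; apply: (@balanced_bracket k a b).
Qed.

(** The same potential pays the L/(1 + l) ballots of a vote, bounded by L/l. The two extra ballots
    are paid by the logarithm, which drops by 6 ln (8/5) >= 9/4 per step. *)
Lemma calls_bisect_long k F a b : 5 / (24 * n%:R) <= b - a ->
  calls mu (bisect k F a b) <=
    6 * ln (5 * n%:R * (b - a)) + L * (8 * n%:R - 5 / 3 / (b - a)).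
Proof.
have n1' := n1; have np : 0 < 24 * n%:R :> R by lra.
elim: F a b => [|F ih] a b l0;
  have l0' : 0 < b - a by [apply: lt_le_trans l0; rewrite divr_gt0];
  have l1 : 1 <= 5 * n%:R * (b - a) by [move: l0; rewrite ler_pdivrMr //; lra];
  have E0 : 0 <= 8 * n%:R - 5 / 3 / (b - a) by
    [rewrite subr_ge0 ler_pdivrMr //; move: l0; rewrite ler_pdivrMr //; lra].
  by rewrite addr_ge0 ?mulr_ge0 ?ln_ge0.
rewrite bisectS; case: ifP => [l3|/negbT]; last rewrite -ltNge => l3.
  by rewrite /= addr_ge0 ?mulr_ge0 ?ln_ge0.
set A := 6 * ln (5 * n%:R * (5 / 8 * (b - a))) + L * (8 * n%:R - 5 / 3 / (5 / 8 * (b - a))).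
have l2 : 5 / (24 * n%:R) <= 5 / 8 * (b - a).
  have -> : 5 / (24 * n%:R) = 5 / 8 * (3 * n%:R)^-1 :> R by field; lra.
  by rewrite ler_wpM2l ?ltW //; lra.
apply: le_trans (calls_bind_le mu_ge0 mu_sum1 (a := A) _ _) _.
  case.
    have lE : a + 5 / 8 * (b - a) - a = 5 / 8 * (b - a) by lra.
    by have := ih a (a + 5 / 8 * (b - a)); rewrite lE; apply.
  have lE : b - (b - 5 / 8 * (b - a)) = 5 / 8 * (b - a) by lra.
  by have := ih (b - 5 / 8 * (b - a)) b; rewrite lE; apply.
apply: le_trans (lerD (le_trans (calls_vote_high _ _ _) (ballots_le (ltW l0'))) (lexx _)) _.
have -> : A = 6 * ln (5 * n%:R * (b - a)) + 6 * ln (5 / 8) +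
    L * (8 * n%:R - 5 / 3 / (b - a)) - L / (b - a).
  rewrite /A (_ : 5 * n%:R * (5 / 8 * (b - a)) = (5 * n%:R * (b - a)) * (5 / 8)); last by ring.
  rewrite lnM ?posrE; [|lra|lra].
  by field; lra.
have ln58 : ln (5 / 8 : R) <= - (3 / 8).
  have -> : 5 / 8 = 1 + - (3 / 8) :> R by lra.
  by apply: le_ln1Dx; lra.
have : L / (1 + (b - a)) <= L / (b - a).
  by rewrite ler_wpM2l // lef_pV2 ?posrE; lra.
lra.
Qed.

Definition bisect_cost D := 6 * ln (1 + 5 * n%:R * D) + 8 * n%:R * L.

Lemma le_bisect_cost D D' : 0 <= D -> D <= D' -> bisect_cost D <= bisect_cost D'.
Proof.
move=> D0 DD; have n1' := n1; have H : 5 * n%:R * D <= 5 * n%:R * D'.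
  by rewrite ler_wpM2l //; lra.
have H0 : 0 <= 5 * n%:R * D by rewrite mulr_ge0 //; lra.
by rewrite /bisect_cost lerD2r ler_wpM2l // ler_ln ?posrE; lra.
Qed.

Lemma ln2_bounds : 2^-1 <= ln (2 : R) <= 1.
Proof.
apply/andP; split.
  rewrite -[X in ln X]invrK lnV ?posrE ?invr_gt0 // lerNr.
  have -> : 2^-1 = 1 + - 2^-1 :> R by lra.
  by apply: le_trans (le_ln1Dx _) _; lra.
have -> : 2 = 1 + 1 :> R by lra.
by apply: le_ln1Dx; lra.
Qed.

Lemma bisect_cost_double D : 0 <= D -> bisect_cost (2 * D) <= bisect_cost D + 6.
Proof.
move=> D0; have n1' := n1.
have H0 : 0 <= n%:R * D by rewrite mulr_ge0 //; lra.
have [_ l2] := andP ln2_bounds.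
suff H : ln (1 + 5 * n%:R * (2 * D)) <= ln 2 + ln (1 + 5 * n%:R * D).
  by rewrite /bisect_cost; lra.
by rewrite -lnM ?posrE ?ler_ln ?posrE; lra.
Qed.

Lemma calls_bisect k F a b : a <= b -> calls mu (bisect k F a b) <= bisect_cost (b - a).
Proof.
move=> ab; have n1' := n1.
have H0 : 0 <= 5 * n%:R * (b - a) by rewrite mulr_ge0 //; lra.
have C0 : 0 <= bisect_cost (b - a).
  by rewrite addr_ge0 ?mulr_ge0 ?ln_ge0 //; lra.
have [l1|l1] := leP (5 / (24 * n%:R)) (b - a).
  have np : 0 < 24 * n%:R :> R by lra.
  have l0' : 0 < b - a by apply: lt_le_trans l1; rewrite divr_gt0.
  apply: le_trans (calls_bisect_long k F l1) _; rewrite /bisect_cost; apply: lerD.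
    have H1 : 0 < 5 * n%:R * (b - a) by rewrite !mulr_gt0 //; lra.
    by rewrite ler_wpM2l // ler_ln ?posrE; lra.
  rewrite [leRHS]mulrC ler_wpM2l // gerBl divr_ge0 ?subr_ge0 //; lra.
have l3 : b - a <= (3 * n%:R)^-1.
  apply: le_trans (ltW l1) _.
  have -> : 5 / (24 * n%:R) = 5 / 8 * (3 * n%:R)^-1 :> R by field; lra.
  by rewrite ler_piMl ?invr_ge0 ?mulr_ge0 //; lra.
by case: F => [|F] //; rewrite bisectS l3.
Qed.

(** The allowance e^(-d) is split in two: half for a premature low answer now, and half for all
    later rounds, whose allowance is e^(-2d) <= e^(-d)/2 because d >= 1. *)
Lemma gallop_wrong k F G d : (bmax - bmin) * (5 / 8) ^+ F <= (3 * n%:R)^-1 -> 1 <= d ->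
  3^-1 <= mass_lt c k bmin -> 3^-1 <= mass_ge c k bmax ->
  prob mu (fun t => ~ balanced c bmin bmax k t) (gallop k F G d) <=
    16 * n%:R * tick + expR (- d).
Proof.
move=> lF d1 Hmin Hmax.
have full : prob mu (fun t => ~ balanced c bmin bmax k t) (bisect k F bmin bmax) <=
    16 * n%:R * tick by apply: bisect_wrong.
have E0 : 0 <= 16 * n%:R * tick by rewrite !mulr_ge0.
elim: G d d1 => [|G ih] d d1; first by rewrite ler_wpDr ?expR_ge0.
rewrite gallopS; case: ifP => [_|/negbT]; first by rewrite ler_wpDr ?expR_ge0.
rewrite -ltNge => dl.
have ed : expR (- d) <= 2^-1.
  by rewrite expRN lef_pV2 ?posrE ?expR_gt0 //; apply: le_trans (expR_ge1Dx _); lra.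
have e2d : expR (- (2 * d)) <= expR (- d) / 2.
  have -> : - (2 * d) = - d + - d by lra.
  by rewrite expRD ler_wpM2l ?expR_ge0.
have ih2 : prob mu (fun t => ~ balanced c bmin bmax k t) (gallop k F G (2 * d)) <=
    16 * n%:R * tick + expR (- d) / 2.
  by apply: le_trans (ih _ _) _; [lra|rewrite lerD2l].
have [H|H] := leP 3^-1 (mass_lt c k (bmax - 2 * d)).
  rewrite /prob expect_bind -[leRHS](expect_const mu_sum1 _ (ask _ (bmax - d))).
  apply: le_expect => // x; case: ifP => _.
    by apply: le_trans ih2 _; have := expR_ge0 (- d); lra.
  rewrite ler_wpDr ?expR_ge0 //; apply: bisect_wrong => //; try lra.
  have lE : bmax - (bmax - 2 * d) = 2 * d by lra.
  rewrite lE; apply: le_trans lF; rewrite ler_wpM2r ?exprn_ge0 //; lra.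
have -> : 16 * n%:R * tick + expR (- d) =
    expR (- d) / 2 + (16 * n%:R * tick + expR (- d) / 2) by lra.
apply: (prob_bind mu_ge0 mu_sum1 (P := fun x : 'I_n.+1 => (k <= x)%N)); last by move=> x ->.
  by apply: addr_ge0 => //; apply: divr_ge0 => //; apply: expR_ge0.
apply: le_trans (_ : mass_lt c k (bmax - d) <= _).
  rewrite /prob expect_ask muE; last by apply/andP; split; lra.
  rewrite /mass_lt [leRHS]big_mkcond /=; apply: ler_sum => x _.
  case: ltnP => kx; last by rewrite asboolF ?mulr0.
  by rewrite ler_piMr ?gibbs_ge0 // lern1 leq_b1.
have O := @odds_fast _ _ _ cv k (bmax - 2 * d) (bmax - d).
have {}O := O ltac:(lra).
have dE : bmax - d - (bmax - 2 * d) = d by lra.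
rewrite dE in O; have S := mass_add cv k (bmax - 2 * d).
have S' := mass_add cv k (bmax - d).
have G0 := mass_lt_ge0 cv k (bmax - d); have G1 := mass_ge_ge0 cv k (bmax - d).
have O1 : expR d * (2 / 3 * mass_lt c k (bmax - d)) <= 3^-1.
  apply: le_trans (le_trans O _).
    by rewrite ler_wpM2l ?expR_ge0 // ler_wpM2r //; lra.
  have H' := ltW H; apply: le_trans (ler_wpM2l G1 H') _; lra.
rewrite expRN; have -> : (expR d)^-1 / 2 = 2^-1 / expR d by rewrite mulrC.
rewrite ler_pdivlMr ?expR_gt0 //; lra.
Qed.

(** From distance q + 2 on a sample is high with probability at most 1/4; the doubling overshoots
    this distance by a factor at most 2 unless it already starts beyond it. *)
Definition reach d := Num.max d (2 * (log_partition_ratio c bmin bmax + 2)).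

Lemma calls_gallop k F G d : (0 < k)%N -> 0 < d -> bmax - bmin <= 2 ^+ G * (2 * d) ->
  calls mu (gallop k F G d) <= bisect_cost (2 * reach d) + 4 + 2 * ln (reach d / d).
Proof.
rewrite /reach; set q := log_partition_ratio _ _ _ => k0 d0 dG; have bb' := bb.
have q0 : 0 <= q.
  by rewrite /q /log_partition_ratio ln_ge0 // ler_pdivlMr ?partition_gt0 // mul1r partition_mono.
have [ln2l ln2u] := andP ln2_bounds.
have direct d' : 0 < d' -> bmax - bmin <= 2 * d' ->
    calls mu (bisect k F bmin bmax) <=
      bisect_cost (2 * Num.max d' (2 * (q + 2))) + 4 + 2 * ln (Num.max d' (2 * (q + 2)) / d').
  move=> d'0 dd; apply: le_trans (calls_bisect k F bb) _.
  have mx : d' <= Num.max d' (2 * (q + 2)) by rewrite le_max lexx.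
  have l0 : 0 <= ln (Num.max d' (2 * (q + 2)) / d').
    by rewrite ln_ge0 // ler_pdivlMr // mul1r.
  have : bisect_cost (bmax - bmin) <= bisect_cost (2 * Num.max d' (2 * (q + 2))).
    by apply: le_bisect_cost; lra.
  lra.
elim: G d d0 dG => [|G ih] d d0 dG.
  by apply: direct => //; move: dG; rewrite expr0 mul1r.
rewrite gallopS; case: ifP => [dd|/negbT]; first exact: direct.
rewrite -ltNge => dl; set m := Num.max d (2 * (q + 2)).
have dm : d <= m by rewrite le_max lexx.
have qm : 2 * (q + 2) <= m by rewrite le_max lexx orbT.
have {}ih := ih (2 * d) ltac:(lra) ltac:(by move: dG; rewrite exprS; lra).
have low : calls mu (bisect k F (bmax - 2 * d) bmax) <= bisect_cost (2 * d).
  apply: le_trans (calls_bisect _ _ _) _; first by lra.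
  by apply: le_bisect_cost; lra.
have lnm : 0 <= ln (m / d) by rewrite ln_ge0 // ler_pdivlMr // mul1r.
(* Below q + 2 nothing is claimed about the answer: the doubling lowers 2 ln(m/d) by 2 ln 2 >= 1,
   which pays for the call. *)
have [dq|dq] := ltP d (q + 2).
  have mE : m = 2 * (q + 2) by rewrite /m max_r //; lra.
  have m2E : Num.max (2 * d) (2 * (q + 2)) = m by rewrite mE max_r //; lra.
  rewrite m2E in ih.
  have lnE : ln (m / d) = ln 2 + ln (m / (2 * d)).
    have -> : m / d = 2 * (m / (2 * d)) by field; lra.
    by rewrite lnM ?posrE ?divr_gt0 //; lra.
  have ln2m : 0 <= ln (m / (2 * d)).
    by rewrite ln_ge0 // ler_pdivlMr ?mul1r ?mE; lra.
  have lw : bisect_cost (2 * d) <= bisect_cost (2 * m) by apply: le_bisect_cost; lra.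
  apply: le_trans (calls_bind_le mu_ge0 mu_sum1
    (a := bisect_cost (2 * m) + 4 + 2 * ln (m / (2 * d))) _ _) _.
    by move=> x; case: ifP => _ //; apply: le_trans low _; lra.
  by rewrite calls_ask lnE; lra.
have m2E : Num.max (2 * d) (2 * (q + 2)) = 2 * d by rewrite max_l //; lra.
rewrite m2E divff ?ln1 ?mulr0 ?addr0 in ih; last by lra.
have {}ih : calls mu (gallop k F G (2 * d)) <= bisect_cost (2 * d) + 10.
  apply: le_trans ih _; have := @bisect_cost_double (2 * d) ltac:(lra); lra.
have tail : mass_ge c k (bmax - d) <= 4^-1.
  apply: le_trans (@mass_ge_tail _ _ _ cv k bmin (bmax - d) bmax k0 _ _) _; [lra|lra|].
  have -> : q - (bmax - (bmax - d)) = (q + 2 - d) + (- 1 + - 1) by lra.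
  rewrite expRD (expRD (- 1)) expRN.
  have e1 : expR (q + 2 - d) <= 1 by rewrite expR_le1; lra.
  have e2 : (expR 1)^-1 <= 2^-1 :> R.
    by rewrite lef_pV2 ?posrE ?expR_gt0 //; apply: le_trans (expR_ge1Dx _); lra.
  have e3 : (expR 1)^-1 * (expR 1)^-1 <= 2^-1 * 2^-1 :> R.
    by rewrite ler_pM ?invr_ge0 ?expR_ge0.
  apply: le_trans (_ : 1 * (2^-1 * 2^-1) <= _); last by lra.
  by rewrite ler_pM ?mulr_ge0 ?invr_ge0 ?expR_ge0.
rewrite calls_bind calls_ask expect_ask.
(* Beyond q + 2, going on costs at most 10 more than bisecting at once and has probability at most
   1/4; 1 + 10/4 fits into the additive 4. *)
apply: le_trans (_ : 1 + (bisect_cost (2 * d) + mass_ge c k (bmax - d) * 10) <= _).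
  rewrite lerD2l.
  have -> : bisect_cost (2 * d) = \sum_x mu (bmax - d) x * bisect_cost (2 * d).
    by rewrite -mulr_suml mu_sum1 mul1r.
  rewrite /mass_ge [X in _ <= _ + X * _]big_mkcond mulr_suml -big_split /=; apply: ler_sum => x _.
  rewrite muE; last by apply/andP; split; lra.
  case: ifP => _.
    by rewrite -mulrDr ler_wpM2l ?gibbs_ge0.
  by rewrite mul0r addr0 ler_wpM2l ?gibbs_ge0.
have : bisect_cost (2 * d) <= bisect_cost (2 * m) by apply: le_bisect_cost; lra.
lra.
Qed.

Lemma search_wrong k F G d : (bmax - bmin) * (5 / 8) ^+ F <= (3 * n%:R)^-1 -> 1 <= d ->
  prob mu (fun t => ~ balanced c bmin bmax k t) (search F G d k) <=
    vote_error 0 + (vote_error 0 + (16 * n%:R * tick + expR (- d))).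
Proof.
move=> lF d1; have e0 := vote_error_ge0 0.
have E0 : 0 <= 16 * n%:R * tick + expR (- d).
  by rewrite addr_ge0 ?expR_ge0 // !mulr_ge0.
have E1 : 0 <= vote_error 0 + (16 * n%:R * tick + expR (- d)) by rewrite addr_ge0.
have Imin : bmin <= bmin <= bmax by rewrite lexx bb.
have Imax : bmin <= bmax <= bmax by rewrite bb lexx.
have half x y : x + y = 1 -> x < 3^-1 -> x <= 2^-1 * expR (- (0 / 8)) * y.
  by rewrite mul0r oppr0 expR0; lra.
have false_prob (b : R) (P : bool -> Prop) : (forall v, P v) ->
    prob mu (fun v => ~ P v) (vote_high k b (ballots 0)) <= vote_error 0.
  move=> PT; rewrite /prob -[leRHS](expect_const mu_sum1 (vote_error 0) (vote_high k b (ballots 0))).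
  by apply: le_expect => // v; rewrite asboolF // => /(_ (PT v)).
apply: (prob_bind mu_ge0 mu_sum1 (P := fun high : bool =>
  if high then 3^-1 <= mass_ge c k bmin else 3^-1 <= mass_lt c k bmin)).
- by [].
- have S := mass_add cv k bmin.
  (* The masses sum to 1, so at most one answer of the vote can be harmful; if both masses are at
     least 1/3, none is. *)
  have [H|H] := ltP (mass_ge c k bmin) 3^-1.
    apply: le_trans (sub_prob mu_ge0 (Q := fun v : bool => v = true) _ _) _.
      by case=> // /(_ ltac:(lra)).
    apply: vote_high_wrong => //; apply: half => //; lra.
  have [H'|H'] := ltP (mass_lt c k bmin) 3^-1.
    apply: le_trans (sub_prob mu_ge0 (Q := fun v : bool => v = false) _ _) _.
      by case.
    apply: vote_low_wrong => //; apply: half => //; lra.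
  by apply: false_prob; case.
case=> Hmin.
  rewrite /prob /= asboolF //.
  by apply; split=> //; [right; lra|left].
apply: (prob_bind mu_ge0 mu_sum1 (P := fun high : bool =>
  if high then 3^-1 <= mass_ge c k bmax else 3^-1 <= mass_lt c k bmax)).
- by [].
- have S := mass_add cv k bmax.
  have [H|H] := ltP (mass_ge c k bmax) 3^-1.
    apply: le_trans (sub_prob mu_ge0 (Q := fun v : bool => v = true) _ _) _.
      by case=> // /(_ ltac:(lra)).
    apply: vote_high_wrong => //; apply: half => //; lra.
  have [H'|H'] := ltP (mass_lt c k bmax) 3^-1.
    apply: le_trans (sub_prob mu_ge0 (Q := fun v : bool => v = false) _ _) _.
      by case.
    apply: vote_low_wrong => //; apply: half => //; lra.
  by apply: false_prob; case.
case=> Hmax; first exact: gallop_wrong.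
rewrite /prob /= asboolF //.
by apply; split=> //; [left|right; lra].
Qed.

Lemma calls_search k F G d : (0 < k)%N -> 0 < d -> bmax - bmin <= 2 ^+ G * (2 * d) ->
  calls mu (search F G d k) <=
    2 * (L + 2) + (bisect_cost (2 * reach d) + 4 + 2 * ln (reach d / d)).
Proof.
set m := reach d => k0 d0 dG; have L0' := L0; have cg := calls_gallop F k0 d0 dG.
have b0 : (ballots 0)%:R <= L + 2.
  by apply: le_trans (ballots_le (lexx 0)) _; rewrite addr0 divr1.
have v0 b : calls mu (vote_high k b (ballots 0)) <= L + 2.
  exact: le_trans (calls_vote_high _ _ _) b0.
have g0 : 0 <= calls mu (gallop k F G d) by apply: calls_ge0.
apply: le_trans (calls_bind_le mu_ge0 mu_sum1
  (a := (L + 2) + (bisect_cost (2 * m) + 4 + 2 * ln (m / d))) _ _) _; last first.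
  by have := v0 bmin; lra.
case; first by move: (le_trans g0 cg); rewrite /=; lra.
apply: le_trans (calls_bind_le mu_ge0 mu_sum1
  (a := bisect_cost (2 * m) + 4 + 2 * ln (m / d)) _ _) _; last first.
  by have := v0 bmax; lra.
by case=> //; exact: le_trans g0 cg.
Qed.

End Search.

(** * Concentration of sample averages *)

Section Estimation.
Variables (R : realType) (n : nat) (bmin bmax : R) (c : 'I_n.+1 -> R).
Hypothesis cv : valid_counts c.
Let mu b := gibbs c (clip bmin bmax b).

Let mu_ge0 b x : 0 <= mu b x.
Proof. exact: gibbs_ge0. Qed.

Let mu_sum1 b : \sum_x mu b x = 1.
Proof. exact: gibbs_sum1. Qed.

(** Multiply by 1 - t <= e^(-t): the product (1 - t)(1 + t + 2t^2) = 1 + t^2 (1 - 2t) is at least 1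
    exactly because t <= 1/2, up to t = 0. *)
Lemma expR_quadratic (t : R) : t <= 2^-1 -> expR t <= 1 + t + 2 * t ^+ 2.
Proof.
move=> t2; have H : 1 - t <= 1 / expR t by rewrite div1r -expRN; apply: expR_ge1Dx.
move: H; rewrite ler_pdivlMr ?expR_gt0 // => H.
have t3 : 0 <= t ^+ 2 * (1 - 2 * t) by rewrite mulr_ge0 ?sqr_ge0 //; lra.
rewrite -(ler_pM2l (_ : 0 < 1 - t)); last by lra.
apply: le_trans H _; rewrite expr2 in t3 *; lra.
Qed.

(** The logarithm lies between 1 - 1/t and t - 1, which differ by (t - 1)^2 / t, and t >= 1/2. *)
Lemma ln_quadratic (t : R) : `|t - 1| <= 2^-1 -> `|ln t - (t - 1)| <= 2 * (t - 1) ^+ 2.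
Proof.
rewrite ler_norml => /andP[t1 t2]; have t0 : 0 < t by lra.
have up : ln t <= t - 1.
  have {1}-> : t = 1 + (t - 1) by ring.
  by apply: le_ln1Dx; lra.
have dn : - ln t <= t^-1 - 1.
  rewrite -lnV ?posrE //; have {1}-> : t^-1 = 1 + (t^-1 - 1) by ring.
  by apply: le_ln1Dx; have : 0 < t^-1 by [rewrite invr_gt0]; lra.
have sq0 := sqr_ge0 (t - 1).
suff : (t - 1) - 2 * (t - 1) ^+ 2 <= 1 - t^-1.
  by rewrite ler_norml => ?; apply/andP; split; lra.
have -> : 1 - t^-1 = (t - 1) / t by field; lra.
rewrite ler_pdivlMr //.
have : 0 <= (t - 1) ^+ 2 * (2 * t - 1) by rewrite mulr_ge0 //; lra.
by rewrite !expr2; lra.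
Qed.

Lemma expR_near1 (z e : R) : 0 <= e <= 2^-1 -> `|z| <= e -> `|expR z - 1| <= 2 * e.
Proof.
move=> /andP[e0 e2]; rewrite !ler_norml => /andP[z1 z2].
have H := expR_ge1Dx z.
have H' : 1 - z <= 1 / expR z by rewrite div1r -expRN; apply: expR_ge1Dx.
move: H'; rewrite ler_pdivlMr ?expR_gt0 // => H'.
apply/andP; split; first by lra.
have : (1 - e) * expR z <= 1.
  by apply: le_trans H'; rewrite ler_wpM2r ?expR_ge0 //; lra.
have E0 : (1 - e) * (1 + 2 * e) - 1 = e * (1 - 2 * e) by ring.
have E1 : 0 <= e * (1 - 2 * e) by rewrite mulr_ge0 //; lra.
move=> H2; rewrite lerBlDr -(ler_pM2l (_ : 0 < 1 - e)); lra.
Qed.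

Lemma mgf_bound b (f : 'I_n.+1 -> R) : (forall x, f x <= 2^-1) ->
  \sum_x gibbs c b x * expR (f x) <= expR (mean c b f + 2 * mean c b (fun x => f x ^+ 2)).
Proof.
move=> f2; apply: le_trans (expR_ge1Dx _).
rewrite -[X in _ <= X + _](gibbs_sum1 cv b) /mean mulr_sumr -!big_split /=; apply: ler_sum => x _.
rewrite mulrCA -!mulrDr -[X in _ <= X + _](mulr1 (gibbs c b x)).
by rewrite -mulrDr ler_wpM2l ?gibbs_ge0 // addrA expR_quadratic.
Qed.

(** One sample at every temperature. Grouping the samples by rounds makes the vector of all averages
    a mean of N independent vectors with one common law. *)
Definition round (bs : seq R) : prog R 'I_n.+1 (seq 'I_n.+1) := mapM (@ask _ _) bs.

Definition rounds N (bs : seq R) := mapM round (nseq N bs).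

Implicit Types (S : seq (seq 'I_n.+1)) (f : 'I_n.+1 -> R).

Definition avg N i f S : R := (\sum_(X <- S) f (nth ord0 X i)) / N%:R.

Lemma avgZ N i a f S : avg N i (fun x => a * f x) S = a * avg N i f S.
Proof. by rewrite /avg -mulr_sumr mulrA. Qed.

Lemma avg0 N i S : avg N i (fun=> 0) S = 0.
Proof. by rewrite /avg big1 // mul0r. Qed.

Section Deviations.
Variables (N : nat) (bs : seq R).
Hypothesis N0 : (0 < N)%N.
Hypothesis size_bs : size bs = n.+1.
Hypothesis bs_in : forall i, (i <= n)%N -> bmin <= nth bmin bs i <= bmax.
Local Notation b := (nth bmin bs).

Let NR0 : (0 : R) < N%:R.
Proof. by rewrite ltr0n. Qed.

Lemma expect_expR_rounds (h : nat -> 'I_n.+1 -> R) :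
  expect mu (fun S => expR (\sum_(X <- S) \sum_(i < n.+1) h i (nth ord0 X i)))
    (rounds N bs) = (\prod_(i < n.+1) \sum_x gibbs c (b i) x * expR (h i x)) ^+ N.
Proof.
under eq_expect do rewrite expR_sum.
rewrite expect_mapM_nseq; congr (_ ^+ _).
under eq_expect do rewrite expR_sum.
have := expect_mapM_prod mu (@ask _ _) bs bmin ord0 (fun i x => expR (h i x)).
rewrite size_bs => ->; apply: eq_bigr => i _; rewrite expect_ask.
by rewrite /mu clip_id // bs_in // -ltnS.
Qed.

(** Bernstein's method with second moments in place of variances. The tilt [lam] is left to the
    callers, whose optimal choices differ. *)
Lemma deviation_upper (h : nat -> 'I_n.+1 -> R) (lam V t : R) :
  0 <= lam -> (forall i x, (i <= n)%N -> lam * h i x <= 2^-1) ->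
  \sum_(i < n.+1) mean c (b i) (fun x => h i x ^+ 2) <= V ->
  prob mu (fun S => t <= \sum_(i < n.+1) (avg N i (h i) S - mean c (b i) (h i)))
    (rounds N bs) <= expR (- (N%:R * (lam * t - 2 * lam ^+ 2 * V))).
Proof.
move=> lam0 lamh HV; set M := \sum_(i < n.+1) mean c (b i) (h i).
have avgE S : \sum_(i < n.+1) avg N i (h i) S =
    (\sum_(X <- S) \sum_(i < n.+1) h i (nth ord0 X i)) / N%:R.
  by rewrite /avg -mulr_suml exchange_big.
apply: le_trans (markov_exp mu_ge0 (f := fun S => - (lam * N%:R * (M + t)) +
  \sum_(X <- S) \sum_(i < n.+1) lam * h i (nth ord0 X i)) _ _) _.
  move=> S; rewrite sumrB avgE -/M lerBrDr => H.
  rewrite addrC subr_ge0; under eq_bigr do rewrite -mulr_sumr.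
  rewrite -mulr_sumr -mulrA ler_wpM2l //.
  by rewrite mulrC -ler_pdivlMr // addrC.
under eq_expect do rewrite expRD.
rewrite expectZ (expect_expR_rounds (fun i x => lam * h i x)).
have step : \prod_(i < n.+1) \sum_x gibbs c (b i) x * expR (lam * h i x) <=
    expR (lam * M + 2 * lam ^+ 2 * V).
  apply: le_trans (_ : \prod_(i < n.+1) expR (lam * mean c (b i) (h i) +
      2 * lam ^+ 2 * mean c (b i) (fun x => h i x ^+ 2)) <= _).
    apply: ler_prod => i _; apply/andP; split.
      by apply: sumr_ge0 => x _; rewrite mulr_ge0 ?expR_ge0 ?gibbs_ge0.
    apply: le_trans (mgf_bound _ _) _; first by move=> x; apply: lamh; rewrite -ltnS.
    rewrite ler_expR le_eqVlt; apply/orP; left; apply/eqP.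
    rewrite /mean !mulr_sumr; congr (_ + _); apply: eq_bigr => x _; ring.
  rewrite -expR_sum ler_expR big_split /= -!mulr_sumr lerD2l ler_wpM2l //.
  by rewrite mulr_ge0 // sqr_ge0.
apply: le_trans (_ : expR (- (lam * N%:R * (M + t))) *
    expR (lam * M + 2 * lam ^+ 2 * V) ^+ N <= _).
  rewrite ler_wpM2l ?expR_ge0 // lerXn2r ?nnegrE ?expR_ge0 //.
  by apply: prodr_ge0 => i _; apply: sumr_ge0 => x _; rewrite mulr_ge0 ?expR_ge0 ?gibbs_ge0.
rewrite -expRM_natl -expRD ler_expR le_eqVlt; apply/orP; left; apply/eqP; ring.
Qed.

Lemma deviation (h : nat -> 'I_n.+1 -> R) (lam V t : R) :
  0 <= lam -> (forall i x, (i <= n)%N -> `|lam * h i x| <= 2^-1) ->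
  \sum_(i < n.+1) mean c (b i) (fun x => h i x ^+ 2) <= V ->
  prob mu (fun S => t <= `|\sum_(i < n.+1) (avg N i (h i) S - mean c (b i) (h i))|)
    (rounds N bs) <= 2 * expR (- (N%:R * (lam * t - 2 * lam ^+ 2 * V))).
Proof.
move=> lam0 lamh HV.
apply: le_trans (_ : prob mu (fun S =>
    t <= \sum_(i < n.+1) (avg N i (h i) S - mean c (b i) (h i)) \/
    t <= \sum_(i < n.+1) (avg N i (fun x => - h i x) S - mean c (b i) (fun x => - h i x)))
    (rounds N bs) <= _).
  apply: sub_prob => // S; rewrite ler_normr => /orP[|H]; first by left.
  right; apply: le_trans H _; rewrite -sumrN le_eqVlt; apply/orP; left; apply/eqP.
  apply: eq_bigr => i _; rewrite opprB addrC /avg /mean sumrN mulNr; congr (_ + _).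
  by rewrite -sumrN; apply: eq_bigr => x _; rewrite mulrN opprK.
apply: le_trans (prob_or mu_ge0 _ _ _) _; rewrite [leRHS]mulr_natl [leRHS]mulr2n.
apply: lerD.
  apply: (@deviation_upper h lam V t lam0) => // i x ni; have := lamh i x ni.
  by rewrite ler_norml => /andP[].
apply: (@deviation_upper (fun i x => - h i x) lam V t lam0).
  by move=> i x ni; have := lamh i x ni; rewrite ler_norml mulrN lerNl => /andP[].
apply: le_trans HV; apply: ler_sum => i _; apply: mean_le => // x.
by rewrite sqrrN.
Qed.

(* The exponent is of order [t ^ 2 / w] rather than [(t / w) ^ 2]: this keeps the
   number of samples per temperature linear in [n]. *)
Lemma relative_deviation (f : nat -> 'I_n.+1 -> R) (P : pred nat) (w t : R) :
  (forall i x, 0 <= f i x <= 1) ->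
  (forall i, (i <= n)%N -> P i -> 4^-1 <= mean c (b i) (f i)) ->
  (\sum_(i < n.+1 | P i) 1 <= w) -> 1 <= w -> 0 <= t <= 2 ->
  prob mu (fun S => t <= `|\sum_(i < n.+1 | P i) (avg N i (f i) S / mean c (b i) (f i) - 1)|)
    (rounds N bs) <= 2 * expR (- (N%:R * t ^+ 2 / (32 * w))).
Proof.
move=> f01 y4 Pw w1 /andP[t0 t2].
pose h i x := if P i then (mean c (b i) (f i))^-1 * f i x else 0.
have y0 i : (i <= n)%N -> P i -> 0 < mean c (b i) (f i).
  by move=> ni /(y4 _ ni); apply: lt_le_trans; rewrite invr_gt0.
have yV i : (i <= n)%N -> P i -> (mean c (b i) (f i))^-1 <= 4.
  by move=> ni Pi; rewrite -[leRHS]invrK lef_pV2 ?posrE ?y0 // y4.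
(* The maximiser of lam t - 8 lam^2 w, the exponent for V = 4w; its value is t^2/(32w). *)
pose lam := t / (16 * w).
have lam0 : 0 <= lam by rewrite divr_ge0 // mulr_ge0 //; lra.
have lam8 : lam * 4 <= 2^-1.
  rewrite /lam mulrAC ler_pdivrMr; last by rewrite mulr_gt0 //; lra.
  lra.
have h0 i x : (i <= n)%N -> 0 <= h i x <= 4.
  move=> ni; rewrite /h; case: ifP => [Pi|_]; last by rewrite lexx ler0n.
  have /andP[f0 f1] := f01 i x; have yi := y0 i ni Pi.
  rewrite mulr_ge0 ?invr_ge0 ?(ltW yi) //=.
  by apply: le_trans (yV i ni Pi); rewrite ler_piMr ?invr_ge0 ?(ltW yi).
have sumE S : \sum_(i < n.+1) (avg N i (h i) S - mean c (b i) (h i)) =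
    \sum_(i < n.+1 | P i) (avg N i (f i) S / mean c (b i) (f i) - 1).
  rewrite [RHS]big_mkcond /=; apply: eq_bigr => i _.
  have ni : (i <= n)%N by rewrite -ltnS.
  rewrite /h; case: ifP => [Pi|_]; last by rewrite avg0 mean_cst // subrr.
  rewrite avgZ mulrC; congr (_ - _); rewrite /mean.
  under eq_bigr do rewrite mulrCA.
  by rewrite -mulr_sumr mulVf // gt_eqF // (y0 i ni Pi).
apply: le_trans (_ : prob mu (fun S => t <= `|\sum_(i < n.+1)
    (avg N i (h i) S - mean c (b i) (h i))|) (rounds N bs) <= _).
  by apply: sub_prob => // S; rewrite sumE.
apply: le_trans (@deviation h lam (4 * w) t lam0 _ _) _.
- move=> i x ni; have /andP[hx0 hx4] := h0 i x ni.
  rewrite ger0_norm; last exact: mulr_ge0.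
  by apply: le_trans lam8; apply: ler_wpM2l.
- apply: le_trans (_ : \sum_(i < n.+1 | P i) 4 <= _); last first.
    have -> : \sum_(i < n.+1 | P i) (4 : R) = 4 * \sum_(i < n.+1 | P i) 1.
      by rewrite mulr_sumr; apply: eq_bigr => i _; rewrite mulr1.
    by rewrite ler_wpM2l.
  rewrite [leRHS]big_mkcond /=; apply: ler_sum => i _.
  have ni : (i <= n)%N by rewrite -ltnS.
  rewrite /h; case: ifP => [Pi|_]; last first.
    by under [X in mean _ _ X]eq_fun do rewrite expr0n; rewrite mean_cst.
  have yi := y0 i ni Pi; apply: le_trans (yV i ni Pi).
  (* As f^2 <= f on [0, 1], the second moment of f divided by its mean is at most the inverse of
     that mean, hence at most 4. *)
  apply: le_trans (_ : mean c (b i) (fun x => (mean c (b i) (f i))^-1 ^+ 2 * f i x) <= _).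
    apply: mean_le => // x; rewrite exprMn ler_wpM2l ?sqr_ge0 //.
    by have /andP[f0 f1] := f01 i x; rewrite expr2 ler_piMr.
  rewrite /mean; under eq_bigr do rewrite mulrCA.
  by rewrite -mulr_sumr expr2 -mulrA mulVf ?mulr1 // gt_eqF.
- rewrite ler_pM2l // ler_expR lerN2 /lam -mulrA ler_wpM2l //.
  by rewrite le_eqVlt; apply/orP; left; apply/eqP; field; lra.
Qed.

End Deviations.

End Estimation.

(** * The estimator *)

Section Estimator.
Variables (R : realType) (n : nat) (bmin bmax delta eps : R).
Local Notation vec := ('I_n.+1 -> R).

Section Estimates.
Variables (N : nat) (bs : seq R) (S : seq (seq 'I_n.+1)).
Local Notation b := (nth bmin bs).

Definition forward i : vec := acceptance (b i) (b i.+1) i.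
Definition backward i : vec := acceptance (b i.+1) (b i) i.

Definition ratio_hat j : R := \prod_(i < j) (expR ((b i.+1 - b i) * i%:R) *
  (avg N i (forward i) S / avg N i.+1 (backward i) S)).

(** Estimates the factor that carries the Gibbs probability of x from [b x] to [bmin]; see
    [gibbs_at_bmin]. *)
Definition scale_hat (x : 'I_n.+1) : R := expR ((bmin - b x) * x%:R) * ratio_hat x.

Definition frequency (x : 'I_n.+1) : R := avg N x (fun y => (y == x)%:R) S.

(* Small frequencies are rounded to 0, so that unreachable states get exactly 0. *)
Definition gibbs_hat (x : 'I_n.+1) : R :=
  if frequency x <= eps / 64 * delta then 0 else frequency x.

(** The radius is an observable proxy for eps pi(x) (1 + delta/Delta(x)). In units of eps (m +
    delta), with m the probability of x at its temperature and up to the scale, the true error is at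
    most 65/1024, while Delta <= 4m allows 1/4; the factor 1/8 lies between them with room for the
    errors of the estimates. *)
Definition estimator : vec * vec :=
  (fun x => gibbs_hat x * scale_hat x,
   fun x => eps / 8 * scale_hat x * (gibbs_hat x + delta)).

End Estimates.

Variables (c : 'I_n.+1 -> R) (N : nat) (bs : seq R).
Hypothesis cv : valid_counts c.
Hypothesis bb : bmin <= bmax.
Hypothesis N0 : (0 < N)%N.
Hypothesis size_bs : size bs = n.+1.
Hypothesis bs0 : nth bmin bs 0 = bmin.
Hypothesis bs_bal : forall k, (k <= n)%N -> balanced c bmin bmax k (nth bmin bs k).
Hypothesis delta01 : 0 < delta < 1.
Hypothesis eps01 : 0 < eps < 1.
Local Notation b := (nth bmin bs).
Local Notation Z := (partition_fun c).

Let y i := mean c (b i) (forward bs i).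
Let z i := mean c (b i.+1) (backward bs i).

Let y4 i : (i < n)%N -> 4^-1 <= y i.
Proof. by move=> ni; have [] := mean_acceptance_ge cv (bs_bal (ltnW ni)) (bs_bal ni). Qed.

Let z4 i : (i < n)%N -> 4^-1 <= z i.
Proof. by move=> ni; have [] := mean_acceptance_ge cv (bs_bal (ltnW ni)) (bs_bal ni). Qed.

Lemma partition_ratio j : (j <= n)%N ->
  Z (b j) / Z bmin = \prod_(i < j) (expR ((b i.+1 - b i) * i%:R) * (y i / z i)).
Proof.
elim: j => [|j ih] jn; first by rewrite big_ord0 bs0 divff // gt_eqF // partition_gt0.
have y0 : 0 < y j by apply: lt_le_trans (y4 jn); rewrite invr_gt0.
have z0 : 0 < z j by apply: lt_le_trans (z4 jn); rewrite invr_gt0.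
rewrite big_ord_recr /= -(ih (ltnW jn)).
have Zj := partition_gt0 cv (b j.+1); have Zm := partition_gt0 cv bmin.
have -> : Z (b j.+1) = Z (b j) * y j * expR ((b j.+1 - b j) * j%:R) / z j.
  apply: (mulIf (lt0r_neq0 z0)); rewrite mulfVK ?gt_eqF //.
  by rewrite /y /z partition_acceptance.
by field; rewrite !gt_eqF.
Qed.

Section Deterministic.
Variables (S : seq (seq 'I_n.+1)) (eta t : R).
Hypothesis eta2 : eta <= 2^-1.
Hypothesis budget : 2 * t + 4 * (n%:R * eta ^+ 2) <= eps / 64.
Let u i := avg N i (forward bs i) S / y i.
Let v i := avg N i.+1 (backward bs i) S / z i.
Hypothesis u_close : forall i, (i < n)%N -> `|u i - 1| <= eta.
Hypothesis v_close : forall i, (i < n)%N -> `|v i - 1| <= eta.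
Hypothesis u_sum : forall j, (j <= n)%N -> `|\sum_(i < j) (u i - 1)| <= t.
Hypothesis v_sum : forall j, (j <= n)%N -> `|\sum_(i < j) (v i - 1)| <= t.

Lemma sum_ln_close (w : nat -> R) j : (j <= n)%N ->
  (forall i, (i < n)%N -> `|w i - 1| <= eta) -> `|\sum_(i < j) (w i - 1)| <= t ->
  `|\sum_(i < j) ln (w i)| <= t + 2 * (n%:R * eta ^+ 2).
Proof.
move=> jn w1 ws.
have -> : \sum_(i < j) ln (w i) =
    \sum_(i < j) (w i - 1) + \sum_(i < j) (ln (w i) - (w i - 1)).
  by rewrite -big_split /=; apply: eq_bigr => i _; ring.
apply: le_trans (ler_normD _ _) (lerD ws _).
apply: le_trans (ler_norm_sum _ _ _) _.
apply: le_trans (_ : \sum_(i < j) 2 * eta ^+ 2 <= _).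
  apply: ler_sum => i _; have wi := w1 i (leq_trans (ltn_ord i) jn).
  apply: le_trans (ln_quadratic (le_trans wi eta2)) _.
  rewrite ler_wpM2l // -(real_normK (num_real (w i - 1))) lerXn2r ?nnegrE //.
  exact: le_trans wi.
rewrite sumr_const card_ord -[X in X <= _]mulr_natl mulrCA ler_wpM2l // ler_wpM2r ?sqr_ge0 //.
by rewrite ler_nat.
Qed.

Lemma ratio_hat_close j : (j <= n)%N ->
  exists2 r, `|r - 1| <= eps / 32 & ratio_hat N bs S j = Z (b j) / Z bmin * r.
Proof.
move=> jn; exists (expR (\sum_(i < j) ln (u i) - \sum_(i < j) ln (v i))).
  have -> : eps / 32 = 2 * (eps / 64) by field.
  apply: expR_near1; first by case/andP: eps01 => e0 e1; apply/andP; split; lra.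
  apply: le_trans (ler_normB _ _) _.
  have := sum_ln_close jn u_close (u_sum jn).
  have := sum_ln_close jn v_close (v_sum jn).
  by move: budget; lra.
rewrite partition_ratio // -sumrB expR_sum -big_split /=; apply: eq_bigr => i _.
have ni : (i < n)%N := leq_trans (ltn_ord i) jn.
have pos a : `|a - 1| <= eta -> 0 < a.
  by rewrite ler_norml => /andP[a1 _]; move: eta2; lra.
have u0 := pos _ (u_close ni); have v0 := pos _ (v_close ni).
have y0 : 0 < y i by apply: lt_le_trans (y4 ni); rewrite invr_gt0.
have z0 : 0 < z i by apply: lt_le_trans (z4 ni); rewrite invr_gt0.
rewrite expRB !lnK ?posrE // -[RHS]mulrA; congr (_ * _).
rewrite /u /v; have : avg N i.+1 (backward bs i) S != 0.
  by apply: contraTneq v0 => a0; rewrite /v a0 mul0r ltxx.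
by move=> a0; field; rewrite a0 !gt_eqF.
Qed.

Hypothesis freq_close : forall x : 'I_n.+1,
  `|frequency N S x - gibbs c (b x) x| <= eps / 64 * (gibbs c (b x) x + delta).

Lemma gibbs_at_bmin x : gibbs c bmin x =
  gibbs c (b x) x * (expR ((bmin - b x) * x%:R) * (Z (b x) / Z bmin)).
Proof.
rewrite /gibbs; have -> : bmin * x%:R = b x * x%:R + (bmin - b x) * x%:R by ring.
by rewrite expRD; field; rewrite !gt_eqF ?partition_gt0.
Qed.

Lemma estimator_correct :
  count_correct c bmin bmax delta eps (estimator N bs S).1 (estimator N bs S).2.
Proof.
have [/andP[e0 e1] /andP[d0 d1]] := (eps01, delta01).
have ed0 : 0 < eps * delta by rewrite mulr_gt0.
split=> x cx; last first.
  (* When c x = 0 the frequency error is at most eps delta/64, exactly the rounding threshold, so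
     the estimate is 0. *)
  rewrite /estimator /= /gibbs_hat; case: ifP; first by rewrite mul0r.
  have g0 : gibbs c (b x) x = 0 by rewrite /gibbs cx !mul0r.
  have := freq_close x; rewrite g0 subr0 add0r ler_norml => /andP[_ ->] //.
have xn : (x <= n)%N by rewrite -ltnS.
have [r r1 rE] := ratio_hat_close xn.
have m0 := gibbs_gt0 cv (b x) cx.
have /andP[D0 D4] := max_gibbs_balanced cv bb cx (bs_bal xn).
pose s := expR ((bmin - b x) * x%:R) * (Z (b x) / Z bmin).
have sE : scale_hat N bs S x = s * r by rewrite /scale_hat rE mulrA.
rewrite /= sE gibbs_at_bmin -/s.
have s0 : 0 < s by rewrite mulr_gt0 ?expR_gt0 ?divr_gt0 ?partition_gt0.
set m := gibbs c (b x) x in m0 D4 *.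
set m' := gibbs_hat _ _ _.
(* Rounding to 0 adds at most another eps delta/64 to the frequency error. *)
have mE : `|m' - m| <= eps / 32 * (m + delta).
  have := freq_close x; rewrite -/m /m' /gibbs_hat !ler_norml.
  have em : 0 < eps * m by rewrite mulr_gt0.
  by case: ifP => [fl|_] /andP[f1 f2]; apply/andP; split; lra.
have D : m + delta / 4 <= m * (1 + delta / max_gibbs c bmin bmax x).
  rewrite mulrDr mulr1 lerD2l mulrA ler_pdivlMr //.
  have : delta / 4 * max_gibbs c bmin bmax x <= delta / 4 * (4 * m).
    by rewrite ler_wpM2l //; lra.
  lra.
move: mE r1; rewrite (ler_norml (m' - m)) (ler_norml (r - 1)) => /andP[m1 m2] /andP[r1 r2].
pose w := eps * (m + delta).
have w0 : 0 < w by rewrite mulr_gt0 //; lra.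
have wE : eps * (m + delta) = w by [].
have wd : w <= m + delta by rewrite /w ler_piMl //; lra.
have m'd : 31 / 32 * (m + delta) <= m' + delta by lra.
have m'u : m' + delta <= 33 / 32 * (m + delta) by lra.
have r31 : 31 / 32 <= r by lra.
have r33 : r <= 33 / 32 by lra.
have X1 : (31 / 32) * (31 / 32 * (m + delta)) <= r * (m' + delta).
  by rewrite ler_pM //; lra.
have X2 : r * (m' + delta) <= (33 / 32) * (33 / 32 * (m + delta)).
  by rewrite ler_pM //; lra.
have Y1 : `|m' * r - m| <= w * (33 / 32 / 32 + 1 / 32).
  have -> : m' * r - m = r * (m' - m) + m * (r - 1) by ring.
  apply: le_trans (ler_normD _ _) _; rewrite (normrM r) (normrM m).
  have A1 : `|r| * `|m' - m| <= 33 / 32 * (w / 32).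
    by rewrite ler_pM ?normr_ge0 // ler_norml; apply/andP; split; lra.
  have A2 : `|m| * `|r - 1| <= (m + delta) * (eps / 32).
    by rewrite ler_pM ?normr_ge0 // ler_norml; apply/andP; split; lra.
  have A3 : (m + delta) * (eps / 32) = w / 32 by rewrite /w; ring.
  by apply: le_trans (lerD A1 A2) _; rewrite A3; lra.
split.
  have -> : m' * (s * r) - m * s = s * (m' * r - m) by ring.
  have -> : eps / 8 * (s * r) * (m' + delta) = s * (eps / 8 * (r * (m' + delta))) by ring.
  rewrite normrM gtr0_norm // ler_wpM2l ?(ltW s0) //; apply: le_trans Y1 _.
  apply: le_trans (_ : eps / 8 * ((31 / 32) * (31 / 32 * (m + delta))) <= _); last first.
    by rewrite ler_wpM2l //; lra.
  lra.
have -> : eps / 8 * (s * r) * (m' + delta) = s * (eps / 8 * (r * (m' + delta))) by ring.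
have -> : eps * (m * s) * (1 + delta / max_gibbs c bmin bmax x) =
  s * (eps * (m * (1 + delta / max_gibbs c bmin bmax x))) by ring.
rewrite ler_wpM2l ?(ltW s0) //.
apply: le_trans (_ : eps * (m + delta / 4) <= _); last by rewrite ler_wpM2l ?(ltW e0).
have : eps / 8 * (r * (m' + delta)) <= eps / 8 * ((33 / 32) * (33 / 32 * (m + delta))).
  by rewrite ler_wpM2l //; lra.
have : 0 < eps * m by rewrite mulr_gt0.
lra.
Qed.

End Deterministic.

Let mu b := gibbs c (clip bmin bmax b).

Let mu_ge0 b x : 0 <= mu b x.
Proof. exact: gibbs_ge0. Qed.

Let mu_sum1 b : \sum_x mu b x = 1.
Proof. exact: gibbs_sum1. Qed.

Let bs_in i : (i <= n)%N -> bmin <= b i <= bmax.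
Proof. by move=> /bs_bal []. Qed.

(** * Deviation events and their union bound *)

Section Probabilistic.
Variables (eta t E : R).
Hypothesis eta01 : 0 <= eta <= 2^-1.
Hypothesis t02 : 0 <= t <= 2.
Hypothesis budget : 2 * t + 4 * (n%:R * eta ^+ 2) <= eps / 64.
Hypothesis E_eta : E <= N%:R * eta ^+ 2 / 32.
Hypothesis E_t : E <= N%:R * t ^+ 2 / (32 * n.+1%:R).
Hypothesis E_delta : E <= N%:R * ((eps / 64) ^+ 2 * delta / 4).
Let p := rounds n N bs.
Let tail := 2 * expR (- E).

Lemma forward_single (i : 'I_n) :
  prob mu (fun S => eta <= `|avg N i (forward bs i) S / y i - 1|) p <= tail.
Proof.
have ni : (i < n.+1)%N by rewrite ltnS ltnW.
have H := @relative_deviation _ _ bmin bmax _ cv N bs N0 size_bs bs_in (forward bs)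
  (fun m => m == i) 1 eta.
apply: le_trans (le_trans (H _ _ _ _ _) _); first last.
- by rewrite ler_pM2l // ler_expR lerN2 mulr1.
- by have := eta01; lra.
- by [].
- by rewrite (big_pred1 (Ordinal ni)).
- by move=> m _ /eqP ->; apply: y4.
- by move=> m x; apply: acceptance01.
by apply: sub_prob => // S; rewrite (big_pred1 (Ordinal ni)).
Qed.

(** Every prefix matters, since pi(x) uses the product of the first x ratios. Each is treated as one
    random variable with at most n + 1 terms, hence the weight n + 1. *)
Lemma forward_prefix (j : 'I_n.+1) :
  prob mu (fun S => t <= `|\sum_(i < j) (avg N i (forward bs i) S / y i - 1)|) p <= tail.
Proof.
have H := @relative_deviation _ _ bmin bmax _ cv N bs N0 size_bs bs_in (forward bs)
  (fun m => (m < j)%N) n.+1%:R t.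
apply: le_trans (le_trans (H _ _ _ _ _) _); first last.
- by rewrite ler_pM2l // ler_expR lerN2.
- exact: t02.
- by rewrite ler1n.
- rewrite big_mkcond /= -[X in _ <= X%:R]card_ord -sumr_const.
  by apply: ler_sum => i _; case: ifP.
- by move=> m _ mj; apply: y4; apply: leq_trans mj _; rewrite -ltnS.
- by move=> m x; apply: acceptance01.
apply: sub_prob => // S.
by rewrite (big_ord_widen_cond n.+1 xpredT
  (fun m => avg N m (forward bs m) S / y m - 1)) // ltnW.
Qed.

(** The backward averages of pair i live at temperature i + 1, whereas [relative_deviation] sums
    over temperature indices; index 0 carries none. *)
Lemma sum_shift (F : nat -> R) (P : pred nat) :
  \sum_(m < n.+1 | (0 < m)%N && P m.-1) F m = \sum_(i < n | P i) F i.+1.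
Proof. by rewrite big_mkcond big_ord_recl /= add0r [RHS]big_mkcond. Qed.

Lemma backward_single (i : 'I_n) :
  prob mu (fun S => eta <= `|avg N i.+1 (backward bs i) S / z i - 1|) p <= tail.
Proof.
have H := @relative_deviation _ _ bmin bmax _ cv N bs N0 size_bs bs_in
  (fun m => backward bs m.-1) (fun m => (0 < m)%N && (m.-1 == i)) 1 eta.
apply: le_trans (le_trans (H _ _ _ _ _) _); first last.
- by rewrite ler_pM2l // ler_expR lerN2 mulr1.
- by have := eta01; lra.
- by [].
- by rewrite (sum_shift (fun=> 1) (fun m => m == i)) (big_pred1 i).
- by move=> [|m] // _ /= /eqP ->; apply: z4.
- by move=> m x; apply: acceptance01.
apply: sub_prob => // S.
rewrite (sum_shift (fun m => avg N m (backward bs m.-1) S /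
  mean c (b m) (backward bs m.-1) - 1) (fun m => m == i)).
by rewrite (big_pred1 i).
Qed.

Lemma backward_prefix (j : 'I_n.+1) :
  prob mu (fun S => t <= `|\sum_(i < j) (avg N i.+1 (backward bs i) S / z i - 1)|) p <= tail.
Proof.
have jn : (j <= n)%N by rewrite -ltnS.
have H := @relative_deviation _ _ bmin bmax _ cv N bs N0 size_bs bs_in
  (fun m => backward bs m.-1) (fun m => (0 < m)%N && (m.-1 < j)%N) n.+1%:R t.
apply: le_trans (le_trans (H _ _ _ _ _) _); first last.
- by rewrite ler_pM2l // ler_expR lerN2.
- exact: t02.
- by rewrite ler1n.
- rewrite big_mkcond /= -[X in _ <= X%:R]card_ord -sumr_const.
  by apply: ler_sum => i _; case: ifP.
- by move=> [|m] // _ /= mj; apply: z4; apply: leq_trans mj jn.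
- by move=> m x; apply: acceptance01.
apply: sub_prob => // S.
rewrite (sum_shift (fun m => avg N m (backward bs m.-1) S /
  mean c (b m) (backward bs m.-1) - 1) (fun m => (m < j)%N)).
by rewrite (big_ord_widen_cond n xpredT
  (fun m => avg N m.+1 (backward bs m) S / z m - 1)).
Qed.

Lemma frequency_wrong (x : 'I_n.+1) :
  prob mu (fun S => eps / 64 * (gibbs c (b x) x + delta) <=
    `|frequency N S x - gibbs c (b x) x|) p <= tail.
Proof.
set m := gibbs c (b x) x.
pose h (i : nat) (w : 'I_n.+1) : R := if i == x then (w == x)%:R else 0.
(* With e = eps/64 and the second moment m of the indicator, the tilt e/4 gives the exponent e^2
   delta/4 + e^2 m/8: at least e^2 delta/4, however small m is. *)
pose lam := eps / 64 / 4.
have [/andP[e0 e1] /andP[d0 d1]] := (eps01, delta01).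
have lam0 : 0 <= lam by rewrite /lam; lra.
have m0 : 0 <= m by apply: gibbs_ge0.
have mE : mean c (b x) (fun w => (w == x)%:R) = m.
  rewrite /mean (bigD1 x) //= eqxx mulr1 big1 ?addr0 // => w /negbTE ->.
  by rewrite mulr0.
have sumE (F : nat -> R) : (forall i, i != x :> nat -> F i = 0) ->
    \sum_(i < n.+1) F i = F x.
  move=> F0; rewrite (bigD1 x) //= big1 ?addr0 // => i ix; exact: F0.
have H := @deviation _ _ bmin bmax _ cv N bs N0 size_bs bs_in h lam m
  (eps / 64 * (m + delta)) lam0.
apply: le_trans (le_trans (H _ _) _); first last.
- rewrite ler_pM2l // ler_expR lerN2; apply: le_trans E_delta _.
  rewrite ler_wpM2l //.
  have -> : lam * (eps / 64 * (m + delta)) - 2 * lam ^+ 2 * m =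
    (eps / 64) ^+ 2 * delta / 4 + (eps / 64) ^+ 2 * m / 8 by rewrite /lam; field.
  by rewrite lerDl divr_ge0 // mulr_ge0 // sqr_ge0.
- rewrite (sumE (fun i => mean c (b i) (fun w => h i w ^+ 2))).
    rewrite -mE le_eqVlt; apply/orP; left; apply/eqP; apply: eq_bigr => w _.
    by rewrite /h eqxx; case: (w == x); rewrite ?expr1n ?expr0n.
  move=> i /negbTE ix; rewrite /mean big1 // => w _.
  by rewrite /h ix expr0n mulr0.
- move=> i w _; have h01 : 0 <= h i w <= 1.
    by rewrite /h; case: ifP; case: (w == x); rewrite ?lexx ?ler01.
  have /andP[h0 h1] := h01.
  rewrite ger0_norm; last exact: mulr_ge0.
  apply: le_trans (ler_piMr lam0 h1) _; rewrite /lam; lra.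
apply: sub_prob => // S.
rewrite (sumE (fun i => avg N i (h i) S - mean c (b i) (h i))); last first.
  move=> i /negbTE ix; rewrite /h ix avg0 /mean big1 ?subrr // => w _.
  by rewrite mulr0.
have -> : h x = fun w => (w == x)%:R by apply/funext => w; rewrite /h eqxx.
by rewrite mE.
Qed.

Lemma estimator_wrong :
  prob mu (fun S => ~ count_correct c bmin bmax delta eps
    (estimator N bs S).1 (estimator N bs S).2) p <= 5 * (n.+1%:R * tail).
Proof.
have tail0 : 0 <= tail by rewrite mulr_ge0 ?expR_ge0.
pose E1 S := exists i : 'I_n, eta <= `|avg N i (forward bs i) S / y i - 1|.
pose E2 S := exists i : 'I_n, eta <= `|avg N i.+1 (backward bs i) S / z i - 1|.
pose E3 S := exists j : 'I_n.+1,
  t <= `|\sum_(i < j) (avg N i (forward bs i) S / y i - 1)|.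
pose E4 S := exists j : 'I_n.+1,
  t <= `|\sum_(i < j) (avg N i.+1 (backward bs i) S / z i - 1)|.
pose E5 S := exists x : 'I_n.+1, eps / 64 * (gibbs c (b x) x + delta) <=
    `|frequency N S x - gibbs c (b x) x|.
have nn : n%:R * tail <= n.+1%:R * tail by rewrite ler_wpM2r // ler_nat.
have P1 : prob mu E1 p <= n.+1%:R * tail.
  by apply: le_trans nn; apply: prob_exists_le => // i; apply: forward_single.
have P2 : prob mu E2 p <= n.+1%:R * tail.
  by apply: le_trans nn; apply: prob_exists_le => // i; apply: backward_single.
have P3 : prob mu E3 p <= n.+1%:R * tail.
  by apply: prob_exists_le => // i; apply: forward_prefix.
have P4 : prob mu E4 p <= n.+1%:R * tail.
  by apply: prob_exists_le => // i; apply: backward_prefix.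
have P5 : prob mu E5 p <= n.+1%:R * tail.
  by apply: prob_exists_le => // i; apply: frequency_wrong.
have U Q1 Q2 a1 a2 : prob mu Q1 p <= a1 -> prob mu Q2 p <= a2 ->
    prob mu (fun S => Q1 S \/ Q2 S) p <= a1 + a2.
  by move=> q1 q2; apply: le_trans (prob_or mu_ge0 _ _ _) (lerD q1 q2).
have := U _ _ _ _ P1 (U _ _ _ _ P2 (U _ _ _ _ P3 (U _ _ _ _ P4 P5))).
have -> : 5 * (n.+1%:R * tail) = n.+1%:R * tail + (n.+1%:R * tail + (n.+1%:R * tail +
  (n.+1%:R * tail + n.+1%:R * tail))) by ring.
apply: le_trans; apply: sub_prob => // S; apply: contra_notP => nE.
have close (F : nat -> R) a (i m : nat) (Q : Prop) : ~ Q -> (forall i : 'I_m, a <= F i -> Q) ->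
    (i < m)%N -> F i <= a.
  move=> nQ FQ im; rewrite leNgt; apply/negP => /ltW ai.
  exact: nQ (FQ (Ordinal im) ai).
apply: (@estimator_correct S eta t) => //.
- by case/andP: eta01.
- move=> i; apply: (close (fun i => `|avg N i (forward bs i) S / y i - 1|) _ _ _ (E1 S)).
    by move=> e; apply: nE; left.
  by move=> i' ?; exists i'.
- move=> i; apply: (close (fun i => `|avg N i.+1 (backward bs i) S / z i - 1|) _ _ _ (E2 S)).
    by move=> e; apply: nE; right; left.
  by move=> i' ?; exists i'.
- move=> j; rewrite -ltnS; apply: (close (fun j =>
    `|\sum_(i < j) (avg N i (forward bs i) S / y i - 1)|) _ _ _ (E3 S)).
    by move=> e; apply: nE; right; right; left.
  by move=> i' ?; exists i'.
- move=> j; rewrite -ltnS; apply: (close (fun j =>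
    `|\sum_(i < j) (avg N i.+1 (backward bs i) S / z i - 1)|) _ _ _ (E4 S)).
    by move=> e; apply: nE; right; right; right; left.
  by move=> i' ?; exists i'.
move=> x; rewrite leNgt; apply/negP => /ltW e; apply: nE.
by do 4 right; exists x.
Qed.

End Probabilistic.
End Estimator.

(** * The complete program *)

Section MainProgram.
Variables (R : realType) (n : nat) (bmin bmax delta eps L d : R) (F G N : nat).
Local Notation vec := ('I_n.+1 -> R).
Hypothesis n0 : (0 < n)%N.
Hypothesis bb : bmin <= bmax.
Hypothesis delta01 : 0 < delta < 1.
Hypothesis eps01 : 0 < eps < 1.
Hypothesis L0 : 0 <= L.
Hypothesis d1 : 1 <= d.
Hypothesis N0 : (0 < N)%N.
Hypothesis bisect_fuel : (bmax - bmin) * (5 / 8) ^+ F <= (3 * n%:R)^-1.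
Hypothesis gallop_fuel : bmax - bmin <= 2 ^+ G * (2 * d).

(** Threshold 0 needs no search: [bmin] is balanced for it. Fixing the length at n + 1 for every [r]
    bounds the calls without tracking the length of the search results. *)
Definition temperatures (r : seq R) : seq R :=
  mkseq (fun i => nth bmin (bmin :: r) i) n.+1.

Definition count_program : prog R 'I_n.+1 (vec * vec) :=
  bind (mapM (fun k => search n bmin bmax L F G d k.+1) (iota 0 n)) (fun r =>
    bind (rounds n N (temperatures r)) (fun S =>
      Ret (estimator bmin delta eps N (temperatures r) S))).

Variable c : 'I_n.+1 -> R.
Hypothesis cv : valid_counts c.
Let mu b := gibbs c (clip bmin bmax b).

Let mu_ge0 b x : 0 <= mu b x.
Proof. exact: gibbs_ge0. Qed.

Let mu_sum1 b : \sum_x mu b x = 1.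
Proof. exact: gibbs_sum1. Qed.

Lemma balanced0 : balanced c bmin bmax 0 bmin.
Proof.
split; [by rewrite lexx bb| |by left]; right.
have -> : mass_ge c 0 bmin = 1 by rewrite /mass_ge -(gibbs_sum1 cv bmin).
by rewrite invf_le1 // ler1n.
Qed.

Lemma count_program_wrong tick eta t E :
  (forall l, 0 < l -> vote_error L l <= tick / l) -> 0 <= tick ->
  0 <= eta <= 2^-1 -> 0 <= t <= 2 ->
  2 * t + 4 * (n%:R * eta ^+ 2) <= eps / 64 ->
  E <= N%:R * eta ^+ 2 / 32 -> E <= N%:R * t ^+ 2 / (32 * n.+1%:R) ->
  E <= N%:R * ((eps / 64) ^+ 2 * delta / 4) ->
  prob mu (fun o => ~ count_correct c bmin bmax delta eps o.1 o.2) count_program <=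
    n%:R * (vote_error L 0 + (vote_error L 0 + (16 * n%:R * tick + expR (- d)))) +
    5 * (n.+1%:R * (2 * expR (- E))).
Proof.
move=> tickP tick0 eta01 t02 budget E1 E2 E3.
have s0 : 0 <= vote_error L 0 + (vote_error L 0 + (16 * n%:R * tick + expR (- d))).
  by rewrite !addr_ge0 ?expR_ge0 ?vote_error_ge0 // !mulr_ge0.
have sw := prob_mapM mu_ge0 mu_sum1 (f := fun k => search n bmin bmax L F G d k.+1) (iota 0 n) 0%N bmin
  (P := fun k => balanced c bmin bmax k.+1) s0
  (fun k => search_wrong bb n0 cv tickP tick0 k.+1 G bisect_fuel d1).
rewrite size_iota in sw; rewrite /count_program.
have e0 : 0 <= 5 * (n.+1%:R * (2 * expR (- E))) by rewrite !mulr_ge0 ?expR_ge0.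
apply: (prob_bind mu_ge0 mu_sum1 e0 sw) => r bal; rewrite /prob expect_bind.
have nthT i : (i <= n)%N -> nth bmin (temperatures r) i = nth bmin (bmin :: r) i.
  by move=> ni; rewrite nth_mkseq.
apply: estimator_wrong => //; first by rewrite size_mkseq.
- move=> [|k] kn; rewrite nthT //=; first exact: balanced0.
  by have := bal k kn; rewrite nth_iota // add0n.
- exact: eta01.
- exact: t02.
- exact: budget.
- exact: E1.
- exact: E2.
Qed.

Lemma calls_rounds bs : calls mu (rounds n N bs) <= N%:R * (size bs)%:R.
Proof.
rewrite /rounds; elim: N => [|m ih] /=; first by rewrite mul0r.
rewrite mulrSr mulrDl mul1r addrC.
have round_le : calls mu (round n bs) <= (size bs)%:R.
  by rewrite -[leRHS]mulr1; apply: calls_mapM => // b; rewrite calls_ask.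
apply: le_trans (lerD round_le ih); apply: calls_bind_le => // X.
by rewrite -[leRHS]addr0; apply: calls_bind_le.
Qed.

(** The reach is at most (d + 6) max(1, q) and occurs under logarithms only: 6 times in the
    bisection cost and 2 times in the doubling, whence the coefficient 8 of the term in q. *)
Lemma calls_count_program :
  calls mu count_program <= n%:R * (10 * n%:R * L + 114 * n%:R + 8 * d +
    8 * ln (Num.max 1 (log_partition_ratio c bmin bmax))) + N%:R * n.+1%:R.
Proof.
set q := log_partition_ratio _ _ _; set Q := Num.max 1 q; have d1' := d1.
have n1 : (1 : R) <= n%:R by rewrite ler1n.
have Q1 : 1 <= Q by rewrite le_max lexx.
have qQ : q <= Q by rewrite le_max lexx orbT.
have lnQ0 : 0 <= ln Q by apply: ln_ge0.
pose m := reach bmin bmax c d.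
have md : d <= m by rewrite /m /reach le_max lexx.
have mQ : m <= (d + 6) * Q.
  have dQ : d * 1 <= d * Q by rewrite ler_wpM2l //; lra.
  by rewrite /m /reach ge_max; apply/andP; split; rewrite -/q; lra.
have m0 : 0 < m by lra.
have lnm : ln m <= d + 5 + ln Q.
  apply: le_trans (_ : ln ((d + 6) * Q) <= _).
    by rewrite ler_ln ?posrE // mulr_gt0; lra.
  rewrite lnM ?posrE; [|lra|lra]; rewrite lerD2r.
  have -> : d + 6 = 1 + (d + 5) by ring.
  by apply: le_ln1Dx; lra.
have lnmd : ln (m / d) <= ln m.
  rewrite ler_ln ?posrE ?divr_gt0 //; last by lra.
  rewrite ler_pdivrMr; last by lra.
  by rewrite ler_peMr //; lra.
have lnn : ln n%:R <= n%:R - 1 :> R.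
  have {1}-> : n%:R = 1 + (n%:R - 1) :> R by ring.
  by apply: le_ln1Dx; lra.
have ln11 : ln 11 <= 10 :> R.
  have -> : 11 = 1 + 10 :> R by lra.
  by apply: le_ln1Dx; lra.
have lnb : ln (1 + 5 * n%:R * (2 * m)) <= ln 11 + ln n%:R + ln m.
  have nm : 1 <= n%:R * m.
    have : 1 * 1 <= n%:R * m by rewrite ler_pM //; lra.
    by rewrite mulr1.
  have n_gt0 : (0 : R) < n%:R by lra.
  have n11 : (0 : R) < 11 * n%:R by lra.
  rewrite -lnM ?posrE //.
  by rewrite -lnM ?posrE // ler_ln ?posrE; lra.
have search_le k : calls mu (search n bmin bmax L F G d k.+1) <=
    10 * n%:R * L + 114 * n%:R + 8 * d + 8 * ln Q.
  apply: le_trans (calls_search bb n0 L0 cv F (ltn0Sn k) (lt_le_trans ltr01 d1) gallop_fuel) _.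
  rewrite -/m /bisect_cost.
  have nL : 1 * L <= n%:R * L by rewrite ler_wpM2r.
  lra.
apply: le_trans (_ : calls mu (mapM (fun k => search n bmin bmax L F G d k.+1) (iota 0 n)) +
  N%:R * n.+1%:R <= _).
  apply: calls_bind_le => // r; rewrite -[leRHS]addr0; apply: le_trans (calls_bind_le
    mu_ge0 mu_sum1 (a := 0) _ _) _ => //.
  rewrite lerD2r; apply: le_trans (calls_rounds _) _.
  by rewrite size_mkseq.
have := calls_mapM mu_ge0 mu_sum1 (iota 0 n) search_le.
by rewrite size_iota lerD2r.
Qed.

End MainProgram.

(** * Choice of the constants *)

Section Constants.
Variable R : realType.
Implicit Types (n : nat) (x g delta eps : R).

(** Here x = gamma/n, and the powers 10, 2 and 4 come from votes, doubling and estimation. The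
    largest term is n x^2 = g x <= g/4. *)
Lemma failure_budget n x g : (2 <= n)%N -> 0 <= x <= 4^-1 -> n%:R * x = g -> g <= 2^-1 ->
  n%:R * (x ^+ 10 + (x ^+ 10 + (16 * n%:R * (320 * x ^+ 10) + x ^+ 2))) +
    5 * (n.+1%:R * (2 * x ^+ 4)) <= g.
Proof.
move=> n2 /andP[x0 x4] nx g2.
have n2R : (2 : R) <= n%:R by rewrite ler_nat.
have g0 : 0 <= g by rewrite -nx mulr_ge0.
(* Normalised so that v <= 1: the large coefficient 5120 n^2 of x^10 becomes (n x)^2 times 5/64
   v^4. *)
pose v := 16 * x ^+ 2.
have v0 : 0 <= v by rewrite /v mulr_ge0 // sqr_ge0.
have v1 : v <= 1.
  have : x * x <= 4^-1 * 4^-1 by rewrite ler_pM.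
  by rewrite /v expr2; lra.
have w4 : 0 <= v ^+ 4 <= 1 by rewrite exprn_ge0 //= exprn_ile1.
have [w40 w41] := andP w4.
have x2 : x ^+ 2 = v / 16 by rewrite /v; field.
have e4 : x ^+ 4 = x * x * (v / 16) by rewrite -x2; ring.
have e10 : x ^+ 10 = x * x * (v ^+ 4 / 256 / 256) by rewrite /v; field.
have nS : n.+1%:R = n%:R + 1 :> R by rewrite -addn1 natrD.
rewrite e10 e4 x2 nS.
have -> : n%:R * (x * x * (v ^+ 4 / 256 / 256) + (x * x * (v ^+ 4 / 256 / 256) +
    (16 * n%:R * (320 * (x * x * (v ^+ 4 / 256 / 256))) + v / 16))) +
    5 * ((n%:R + 1) * (2 * (x * x * (v / 16)))) =
  (n%:R * x) * (2 * x * (v ^+ 4 / 256 / 256)) +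
  (n%:R * x) * (n%:R * x) * (5 / 64 * v ^+ 4) + n%:R * (v / 16) +
  10 * ((n%:R * x) * x * (v / 16)) + 10 * (x * x * (v / 16)) by field.
have -> : n%:R * (v / 16) = (n%:R * x) * x by rewrite -x2; ring.
rewrite nx.
have b1 : g * (2 * x * (v ^+ 4 / 256 / 256)) <= g * (1 / 16).
  rewrite ler_wpM2l //; apply: le_trans (_ : 2 * x * (1 / 16) <= _).
    rewrite ler_wpM2l //; last by lra.
    by rewrite mulr_ge0.
  lra.
have b2 : g * g * (5 / 64 * v ^+ 4) <= g * (1 / 16).
  rewrite -mulrA ler_wpM2l //; apply: le_trans (_ : 2^-1 * (5 / 64) <= _); last by lra.
  rewrite ler_pM //; [by rewrite mulr_ge0 //; lra|lra].
have b3 : g * x <= g * 4^-1 by rewrite ler_wpM2l.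
have b4 : g * x * (v / 16) <= g * (1 / 64).
  rewrite -mulrA ler_wpM2l //; apply: le_trans (_ : 4^-1 * (1 / 16) <= _); last by lra.
  by rewrite ler_pM //; lra.
have b5 : x * x * (v / 16) <= 2^-1 * g * (1 / 64).
  apply: le_trans (_ : x * (4^-1 * (1 / 16)) <= _).
    by rewrite -mulrA ler_wpM2l // ler_pM //; lra.
  have : 2 * x <= g by rewrite -nx ler_wpM2r.
  lra.
lra.
Qed.

Lemma expR_fuel (y : R) : exists G, y <= 2 ^+ G.
Proof.
exists (Num.truncn y).+1; apply: ltW; apply: lt_le_trans (truncnS_gt y) _.
by rewrite -natrX ler_nat ltnW // ltn_expl.
Qed.

Lemma contraction_fuel (y z : R) : 0 <= y -> 0 < z -> exists F, y * (5 / 8) ^+ F <= z.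
Proof.
move=> y0 z0; have [G yG] := expR_fuel (y / z).
exists (2 * G)%N; have half : (5 / 8) ^+ (2 * G) <= (2^-1) ^+ G :> R.
  by rewrite exprM lerXn2r ?nnegrE ?exprn_ge0 //; rewrite ?expr2; lra.
apply: le_trans (ler_wpM2l y0 half) _.
by rewrite exprVn ler_pdivrMr ?exprn_gt0 // mulrC -ler_pdivrMr.
Qed.

(** The constant 256 enters as a variable, so that its powers stay symbolic in the algebraic
    identities. The program is fixed before the counts; its fuel depends on n, g and the interval
    only. *)
Lemma count_program_exists (p : R) n (bmin bmax delta eps g : R) :
  p = 256 -> (2 <= n)%N -> bmin < bmax -> 0 < delta < 1 -> 0 < eps < 1 ->
  0 < g <= 2^-1 ->
  exists P : prog R 'I_n.+1 (('I_n.+1 -> R) * ('I_n.+1 -> R)),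
  forall c, valid_counts c ->
    prob (fun b => gibbs c (clip bmin bmax b))
      (fun o => ~ count_correct c bmin bmax delta eps o.1 o.2) P <= g /\
    calls (fun b => gibbs c (clip bmin bmax b)) P <=
      (4 * (125 * p + 130 + 4 * p ^+ 3) + 8) *
      count_cost_bound n delta eps g (log_partition_ratio c bmin bmax).
Proof.
move=> pE n2 bb delta01 eps01 /andP[g0 g2].
have [/andP[d0 d1] /andP[e0 e1]] := (delta01, eps01).
have n2R : (2 : R) <= n%:R by rewrite ler_nat.
have n0 : (0 < n)%N by apply: ltnW.
have ng : 0 < n%:R / g by rewrite divr_gt0 //; lra.
pose Lam := ln (n%:R / g).
have /andP[ln2l _] := ln2_bounds R.
have Lam1 : 1 <= Lam.
  apply: le_trans (_ : ln (2 * 2) <= _); first by rewrite lnM ?posrE //; lra.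
  by rewrite ler_ln ?posrE // ler_pdivlMr //; lra.
pose x := expR (- Lam).
have xE : x = g / n%:R by rewrite /x expRN lnK ?posrE // invf_div.
have nx : n%:R * x = g by rewrite xE; field; lra.
have x0 : 0 <= x by apply: expR_ge0.
have x4 : x <= 4^-1 by rewrite xE ler_pdivrMr; lra.
have p0 : 0 < p by rewrite pE ltr0n.
have [P3 P3E] : exists P3, P3 = p ^+ 3 by exists (p ^+ 3).
have P30 : 0 < P3 by rewrite P3E exprn_gt0.
have P31 : 1 <= P3 by rewrite P3E exprn_ege1 // pE ler1n.
(* Makes [vote_error L 0] equal to x^10; likewise the initial distance 2 Lam makes e^(-d) equal to
   x^2. *)
pose L := 320 * (10 * Lam).
(* Samples per temperature: the summand n serves the ratios, and 1/delta the frequencies. *)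
pose A := P3 * (Lam * (n%:R + delta^-1) / eps ^+ 2).
pose N := (Num.truncn A).+1.
(* The parts 2t and 4n eta^2 of the budget are both 2 eps/p and together give eps/64; this is where
   256 comes from. *)
pose t := eps / p.
pose eta := Num.sqrt (eps / (2 * p * n%:R)).
have [G gf] := expR_fuel (bmax - bmin).
have [F bf] : exists F, (bmax - bmin) * (5 / 8) ^+ F <= (3 * n%:R)^-1.
  by apply: contraction_fuel; [lra|rewrite invr_gt0; lra].
have gallopf : bmax - bmin <= 2 ^+ G * (2 * (2 * Lam)).
  apply: le_trans gf _; rewrite ler_peMr ?exprn_ge0 //; lra.
have L0 : 0 <= L by rewrite /L; lra.
have e20 : 0 < eps ^+ 2 by rewrite exprn_gt0.
have e21 : eps ^+ 2 <= 1 by rewrite exprn_ile1 // ltW.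
have e2V : 1 <= (eps ^+ 2)^-1 by rewrite invf_ge1.
have dV1 : 1 <= delta^-1 by rewrite invf_ge1 // ltW.
have Lam0 : 0 < Lam by lra.
have NA : A <= N%:R by apply/ltW/truncnS_gt.
have A1 : P3 * (Lam * n%:R / eps ^+ 2) <= N%:R.
  apply: le_trans NA; rewrite ler_pM2l // ler_pM2r ?invr_gt0 // ler_pM2l //; lra.
have A2 : P3 * (Lam * delta^-1 / eps ^+ 2) <= N%:R.
  apply: le_trans NA; rewrite ler_pM2l // ler_pM2r ?invr_gt0 // ler_pM2l //; lra.
have eta_sq : eta ^+ 2 = eps / (2 * p * n%:R).
  by rewrite sqr_sqrtr // divr_ge0 ?(ltW e0) // !mulr_ge0 ?(ltW p0).
have eta0 : 0 <= eta by apply: sqrtr_ge0.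
have pn : 0 < 2 * p * n%:R by rewrite !mulr_gt0 //; lra.
exists (count_program n bmin bmax delta eps L (2 * Lam) F G N) => c cv; split.
  have voteE l : vote_error L l = x ^+ 10 * expR (- (l / 320)).
    by rewrite /vote_error /x -expRM_natl -expRD; congr expR; rewrite /L; lra.
  (* From e^y >= y at y = l/320. *)
  have tickP l : 0 < l -> vote_error L l <= 320 * x ^+ 10 / l.
    move=> l0; have -> : 320 * x ^+ 10 / l = x ^+ 10 * (320 / l) by rewrite -mulrA mulrCA.
    rewrite voteE ler_wpM2l ?exprn_ge0 //.
    rewrite expRN -div1r ler_pdivrMr ?expR_gt0 // mulrAC ler_pdivlMr //.
    by have := expR_ge1Dx (l / 320); lra.
  have tick0 : 0 <= 320 * x ^+ 10 by apply: mulr_ge0; [exact: ler0n|exact: exprn_ge0].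
  have eta01 : 0 <= eta <= 2^-1.
    rewrite eta0 -(ler_pXn2r (ltn0Sn 1)) ?nnegrE ?invr_ge0 ?ler0n //.
    by rewrite eta_sq ler_pdivrMr // pE expr2; lra.
  have t02 : 0 <= t <= 2.
    by rewrite /t pE; apply/andP; split; lra.
  have budget : 2 * t + 4 * (n%:R * eta ^+ 2) <= eps / 64.
    rewrite eta_sq /t le_eqVlt; apply/orP; left; apply/eqP.
    have -> : eps / 64 = 4 * eps / p by rewrite pE; field.
    by field; lra.
  have eta2_0 : 0 <= eta ^+ 2 by apply: sqr_ge0.
  have E1 : 4 * Lam <= N%:R * eta ^+ 2 / 32.
    have : P3 * (Lam * n%:R / eps ^+ 2) * eta ^+ 2 <= N%:R * eta ^+ 2 by rewrite ler_wpM2r.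
    have -> : P3 * (Lam * n%:R / eps ^+ 2) * eta ^+ 2 = 2^-1 * p * p * (Lam / eps).
      by rewrite eta_sq P3E; field; lra.
    have : Lam <= Lam / eps by rewrite ler_pdivlMr // ler_piMr // ltW.
    rewrite pE; lra.
  have E2 : 4 * Lam <= N%:R * t ^+ 2 / (32 * n.+1%:R).
    have : P3 * (Lam * n%:R / eps ^+ 2) * t ^+ 2 <= N%:R * t ^+ 2.
      by rewrite ler_wpM2r // sqr_ge0.
    have -> : P3 * (Lam * n%:R / eps ^+ 2) * t ^+ 2 = p * (Lam * n%:R).
      by rewrite /t P3E; field; lra.
    have nS : n.+1%:R = n%:R + 1 :> R by rewrite -addn1 natrD.
    have : Lam * 1 <= Lam * n%:R by rewrite ler_wpM2l ?(ltW Lam0) //; lra.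
    rewrite nS ler_pdivlMr; last by lra.
    rewrite pE; lra.
  have E3 : 4 * Lam <= N%:R * ((eps / 64) ^+ 2 * delta / 4).
    have ed0 : 0 <= (eps / 64) ^+ 2 * delta / 4.
      by rewrite divr_ge0 // mulr_ge0 ?sqr_ge0 ?(ltW Lam0) ?(ltW d0).
    apply: le_trans (ler_wpM2r ed0 A2).
    have -> : P3 * (Lam * delta^-1 / eps ^+ 2) * ((eps / 64) ^+ 2 * delta / 4) =
        (p / 64) * (p / 64) * (p / 4) * Lam by rewrite P3E; field; lra.
    rewrite pE; lra.
  have d1' : 1 <= 2 * Lam by lra.
  have W := count_program_wrong G n0 (ltW bb) delta01 eps01 d1' (ltn0Sn _) bf cv
    tickP tick0 eta01 t02 budget E1 E2 E3.
  apply: le_trans W _.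
  have -> : vote_error L 0 = x ^+ 10 by rewrite voteE mul0r oppr0 expR0 mulr1.
  have xX k : expR (- (k%:R * Lam)) = x ^+ k by rewrite /x -expRM_natl mulrN.
  by rewrite !xX; apply: failure_budget => //; rewrite x0 x4.
have d1' : 1 <= 2 * Lam by lra.
apply: le_trans (calls_count_program delta eps F N n0 (ltW bb) L0 d1' gallopf cv) _.
rewrite -P3E /count_cost_bound -/Lam; set lnQ := ln (Num.max 1 _).
have lnQ0 : 0 <= lnQ by apply: ln_ge0; rewrite le_max lexx.
set u := ln n%:R; set w := ln (1 / g).
have u2 : 2^-1 <= u.
  by apply: le_trans ln2l _; rewrite ler_ln ?posrE //; lra.
have w2 : 2^-1 <= w.
  apply: le_trans ln2l _; rewrite ler_ln ?posrE ?divr_gt0 // ler_pdivlMr //; lra.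
have LamE : Lam = u + w.
  by rewrite /Lam /u /w -lnM ?posrE ?divr_gt0 ?div1r //; lra.
have uw : Lam <= 4 * (u * w).
  have : 0 <= (u - 2^-1) * (w - 2^-1) by apply: mulr_ge0; lra.
  rewrite LamE; lra.
pose T0 := (n%:R / delta * Lam + n%:R ^+ 2 * u * w) / eps ^+ 2.
pose Y := (n%:R / delta * Lam + n%:R ^+ 2 * Lam) / eps ^+ 2.
have nL : 0 <= n%:R / delta * Lam by rewrite mulr_ge0 ?divr_ge0 ?(ltW d0) ?(ltW Lam0).
have Y4 : Y <= 4 * T0.
  rewrite /Y /T0 mulrA ler_pM2r ?invr_gt0 //.
  have : n%:R ^+ 2 * Lam <= n%:R ^+ 2 * (4 * (u * w)) by rewrite ler_wpM2l ?sqr_ge0.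
  lra.
have nnY : n%:R ^+ 2 * Lam <= Y.
  rewrite /Y ler_pdivlMr //; apply: le_trans (_ : n%:R ^+ 2 * Lam * 1 <= _).
    by rewrite ler_wpM2l // mulr_ge0 ?sqr_ge0 ?(ltW Lam0) ?(ltW d0).
  by rewrite mulr1 lerDr.
have NY : N%:R * n.+1%:R <= 4 * P3 * Y.
  have A1' : 1 <= A.
    have mul1 (a b : R) : 1 <= a -> 1 <= b -> 1 <= a * b.
      by move=> a1 b1; apply: (le_trans a1); rewrite ler_peMr // (le_trans ler01 a1).
    by rewrite /A !mul1 //; lra.
  have N2 : N%:R <= 2 * A.
    have A0 : 0 <= A by lra.
    have /andP[tA _] := truncn_itv A0.
    by rewrite /N -addn1 natrD; lra.
  have -> : 4 * P3 * Y = 2 * A * (2 * n%:R) by rewrite /Y /A; field; lra.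
  rewrite ler_pM ?ler0n // -addn1 natrD; lra.
have main : n%:R * (10 * n%:R * L + 114 * n%:R + 8 * (2 * Lam)) <=
    (125 * p + 130) * (n%:R ^+ 2 * Lam).
  have nnL : n%:R * n%:R * 1 <= n%:R * n%:R * Lam by rewrite ler_wpM2l // mulr_ge0.
  have nL' : 1 * (n%:R * Lam) <= n%:R * (n%:R * Lam).
    by rewrite ler_wpM2r ?mulr_ge0 ?(ltW Lam0) //; lra.
  by rewrite /L pE expr2; lra.
have main' : (125 * p + 130) * (n%:R ^+ 2 * Lam) <= (125 * p + 130) * Y.
  by rewrite ler_wpM2l //; lra.
have K0 : 0 <= 125 * p + 130 + 4 * P3 by lra.
have fin : (125 * p + 130 + 4 * P3) * Y <= (125 * p + 130 + 4 * P3) * (4 * T0).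
  by rewrite ler_wpM2l.
have T00 : 0 <= T0.
  have : 0 <= n%:R ^+ 2 * Lam by rewrite mulr_ge0 ?sqr_ge0 ?(ltW Lam0) ?(ltW d0).
  lra.
have nQ : 0 <= n%:R * lnQ by rewrite mulr_ge0.
have KnQ : 0 <= (125 * p + 130 + 4 * P3) * (n%:R * lnQ) by rewrite mulr_ge0.
rewrite -/T0; lra.
Qed.
End Constants.

(** * Failure probabilities above one half *)

Lemma cost_bound_ge0 (R : realType) (n : nat) (delta eps gamma q : R) : (2 <= n)%N ->
  0 < delta < 1 -> 0 < eps < 1 -> 0 < gamma < 1 -> 0 <= count_cost_bound n delta eps gamma q.
Proof.
move=> n2 /andP[d0 _] /andP[e0 _] /andP[g0 g1].
have n1 : (1 : R) <= n%:R by rewrite ler1n ltnW.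
have g1V : 1 <= gamma^-1 by rewrite invf_ge1 // ltW.
rewrite addr_ge0 ?mulr_ge0 ?ln_ge0 ?le_max ?lexx // ?invr_ge0 ?sqr_ge0 //.
by rewrite addr_ge0 ?mulr_ge0 ?sqr_ge0 ?ln_ge0 ?invr_ge0 ?(ltW d0) ?div1r //;
  rewrite -[leLHS]mulr1 ler_pM.
Qed.

(* For failure probabilities above 1/2 the algorithm gives up with a constant
   probability, which makes the cost vanish like [1 - gamma]. *)
Lemma cost_bound_lazy (R : realType) (n : nat) (delta eps gamma q : R) : (2 <= n)%N ->
  0 < delta < 1 -> 0 < eps < 1 -> 0 < gamma < 1 ->
  Num.min 1 (2 * (1 - gamma)) * count_cost_bound n delta eps (Num.min gamma 2^-1) q <=
  2 * count_cost_bound n delta eps gamma q.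
Proof.
move=> n2 d01 e01 g01; have [/andP[d0 _] /andP[e0 _] /andP[g0 g1]] := And3 d01 e01 g01.
have B0 := cost_bound_ge0 q n2 d01 e01 g01.
have [g2|g2] := leP gamma 2^-1.
  rewrite min_l; last by lra.
  by rewrite mul1r ler_peMl // ler1n.
rewrite min_r; last by lra.
have n2R : (2 : R) <= n%:R by rewrite ler_nat.
rewrite /count_cost_bound invrK !mul1r.
set s := 2 * (1 - gamma); set Q := ln (Num.max 1 q).
have s0 : 0 <= s by rewrite /s; lra.
have s1 : s <= 1 by rewrite /s; lra.
have Q0 : 0 <= Q by rewrite ln_ge0 // le_max lexx.
have /andP[ln2l ln2u] := ln2_bounds R.
have lnn : ln 2 <= ln n%:R :> R by rewrite ler_ln ?posrE //; lra.
(* The probability 2(1 - gamma) of running the program is thus at most 2 ln(1/gamma), the factor by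
   which the bound may vanish as gamma tends to 1. *)
have lng : 1 - gamma <= ln gamma^-1.
  rewrite lnV ?posrE //; have {2}-> : gamma = 1 + (gamma - 1) by ring.
  by have := @le_ln1Dx _ (gamma - 1); lra.
have e20 : 0 < eps ^+ 2 by rewrite exprn_gt0.
have A1 : ln (n%:R * 2) <= 2 * ln (n%:R / gamma).
  by rewrite !lnM ?posrE ?invr_gt0 //; lra.
have lnn0 : 0 <= ln (n%:R * 2 : R) by apply: ln_ge0; lra.
have A2 : s * ln (n%:R * 2) <= 2 * ln (n%:R / gamma).
  by apply: le_trans A1; rewrite ler_piMl.
have A3 : s * ln 2 <= 2 * ln gamma^-1.
  by apply: le_trans (_ : s * 1 <= _); [rewrite ler_wpM2l|rewrite /s; lra].
have A4 : s * (n%:R * Q) <= 2 * (n%:R * Q).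
  by rewrite ler_wpM2r ?mulr_ge0 //; lra.
rewrite [leLHS]mulrDr [leRHS]mulrDr lerD //.
rewrite [leLHS]mulrA [leRHS]mulrA ler_pM2r ?invr_gt0 // [leLHS]mulrDr [leRHS]mulrDr lerD //.
  rewrite [leLHS]mulrCA [leRHS]mulrCA ler_wpM2l // divr_ge0 // ltW //.
by rewrite [leLHS]mulrCA [leRHS]mulrCA ler_wpM2l // mulr_ge0 ?sqr_ge0 //; lra.
Qed.

Theorem theorem41 (R : realType) :
  exists C : R, 0 < C /\
  forall (n : nat) (bmin bmax delta eps gamma : R),
    (2 <= n)%N -> bmin < bmax ->
    0 < delta < 1 -> 0 < eps < 1 -> 0 < gamma < 1 ->
    exists A : algorithm n bmin bmax,
      forall c : 'I_n.+1 -> R, valid_counts c ->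
        ((1 - gamma)%:E <= success_probability A c delta eps)%E /\
        (expected_calls A c <=
           (C * count_cost_bound n delta eps gamma
                  (log_partition_ratio c bmin bmax))%:E)%E.
Proof.
have [p pE] : exists p : R, p = 256 by exists 256.
have [K KE] : exists K : R, K = 4 * (125 * p + 130 + 4 * p ^+ 3) + 8 by eexists.
have K0 : 0 < K.
  have : 0 <= p ^+ 3 by apply: exprn_ge0; rewrite pE ler0n.
  by rewrite KE pE; lra.
exists (K * 2); split; first by rewrite mulr_gt0.
move=> n bmin bmax delta eps gamma n2 bb d01 e01 g01.
have /andP[g0 g1] := g01.
have gmin : 0 < Num.min gamma 2^-1 <= 2^-1.
  by rewrite lt_min g0 invr_gt0 ltr0n ge_min lexx orbT.
have [P HP] := count_program_exists pE n2 bb d01 e01 gmin.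
(* For gamma > 1/2 the program runs with failure probability 1/2, and 2(1 - gamma) times 1/2 is
   exactly the required 1 - gamma; otherwise s = 1. *)
pose s := Num.min 1 (2 * (1 - gamma)).
have s01 : 0 <= s <= 1.
  by rewrite le_min ler01 /= ge_min lexx /= andbT mulr_ge0 //; lra.
have [s0 s1] := andP s01.
(* The second program gives up without any call, so the expected cost is scaled by s. *)
exists (compiled (ltW bb) s (fun w => if w then P else Ret (fun=> 0, fun=> 0))) => c cv.
have [wrong cost] := HP c cv.
have mu_ge0 b x : 0 <= gibbs c (clip bmin bmax b) x by apply: gibbs_ge0.
have mu_sum1 b : \sum_x gibbs c (clip bmin bmax b) x = 1 by apply: gibbs_sum1.
split.
  rewrite success_compiled // lee_fin.
  apply: le_trans (_ : s * (1 - Num.min gamma 2^-1) <= _).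
    rewrite /s; have [g2|g2] := leP gamma 2^-1.
      by rewrite min_l; lra.
    by rewrite min_r; lra.
  apply: ler_wpDr; first by apply: mulr_ge0; [rewrite subr_ge0|apply: prob_ge0].
  by rewrite ler_wpM2l //; move: wrong; rewrite probC //; lra.
rewrite expected_calls_compiled // lee_fin mulr0 addr0 -mulrA.
apply: le_trans (_ : s * (K * count_cost_bound n delta eps (Num.min gamma 2^-1)
  (log_partition_ratio c bmin bmax)) <= _); first by rewrite ler_wpM2l // KE.
by rewrite mulrCA ler_pM2l // cost_bound_lazy.
Qed.
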